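(* Let $\tau\in[0,\infty)$ and let $(X,f)$ be a dynamical system satisfying the non-uniform $\tau$-specification property. Then for any two distinct ergodic measures $\mu,\nu\in\mathcal{M}_f^{erg}(X)$ and any non-empty open set $U\subset X$, there exists an uncountable DC1-scrambled set contained in $(G^{\mu}\setminus G^{\nu})\cap U\cap\mathrm{Trans}(f)$.
   Context: A dynamical system $(X,f)$ consists of a compact metric space $(X,d)$ with at least two points and a continuous map $f:X\to X$. $\mathbb{N}$ denotes the positive integers. $\mathcal{M}_f^{erg}(X)$ is the set of $f$-ergodic ($f$-invariant) Borel probability measures on $X$; measures carry the weak* topology. Non-uniform specification property: $(X,f)$ satisfies the non-uniform specification property with gap function $M(n,\varepsilon):\mathbb{N}\times(0,+\infty)\to\mathbb{N}$ if (i) $M(n,\varepsilon)$ is non-decreasing in $n$ and non-increasing in $\varepsilon$; (ii) for every $\varepsilon>0$, any integer $k\ge2$, any $x_1,\dots,x_k\in X$ and any non-negative integers $a_1\le b_1<a_2\le b_2<\cdots<a_k\le b_k$ with $a_{i+1}-b_i\ge M(b_i-a_i+1,\varepsilon)$ for $1\le i\le k-1$, there exists $z\in X$ such that $d(f^{n-a_i}x_i,f^nz)\le\varepsilon$ for all $a_i\le n\le b_i$ and $1\le i\le k$. Non-uniform $\tau$-specification property: let $\mathscr{G}(X,f)$ be the collection of all gap functions for which $(X,f)$ satisfies the non-uniform specification property, and for $M\in\mathscr{G}(X,f)$ let $\tau(M)=\sup_{\varepsilon>0}\liminf_{n\to\infty}\frac{M(n,\varepsilon)}{n}$. $(X,f)$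 satisfies the non-uniform $\tau$-specification property if there is $M\in\mathscr{G}(X,f)$ with $\tau(M)=\tau$ and every $M'\in\mathscr{G}(X,f)$ satisfies $\tau(M')\ge\tau$. For $x\in X$ and $n\in\mathbb{N}$ let $\delta_x^n=\frac1n\sum_{k=0}^{n-1}\delta_{f^kx}$, and let $V_f(x)$ be the set of weak* accumulation points of $\{\delta_x^n\}_{n\ge1}$. For an invariant measure $\mu$, $G^{\mu}=\{x\in X:\mu\in V_f(x)\}$. $\mathrm{Trans}(f)=\{x\in X:\omega(x,f)=X\}$, where $\omega(x,f)$ is the $\omega$-limit set of $x$. A pair $\{x,y\}$ is DC1-scrambled if for every $t>0$, $\limsup_{n\to\infty}\frac1n|\{j\in[0,n-1]:d(f^jx,f^jy)<t\}|=1$, and there exists $t_0>0$ such that $\liminf_{n\to\infty}\frac1n|\{j\in[0,n-1]:d(f^jx,f^jy)<t_0\}|=0$ (here $j$ ranges over integers). A set $S\subset X$ is DC1-scrambled if each pair of distinct points of $S$ is DC1-scrambled. *)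

(* Defs.v *)
From HB Require Import structures.
From mathcomp Require Export all_boot all_order all_algebra.
From mathcomp Require Export all_classical all_reals all_analysis.
Export Order.TTheory GRing.Theory Num.Theory.
Export numFieldNormedType.Exports.

Set Implicit Arguments.
Unset Strict Implicit.
Unset Printing Implicit Defensive.

Local Open Scope classical_set_scope.
Local Open Scope ring_scope.

(* The library's measurable types are pointed.  The spaces considered below are
   nonempty, so a base point can be chosen; nothing depends on which one. *)
#[short(type="pmetricType")]
HB.structure Definition PMetric (R : numDomainType) :=
  {T of Metric R T & isPointed T}.

Notation borel T := (g_sigma_algebraType (@open T)).

Section DynamicalSystems.
Context {R : realType} {X : pmetricType R}.
Implicit Types (f : X -> X) (M : nat -> R -> nat) (x y : X).

Definition dynamical_system f :=
  [/\ compact [set: X], (exists x y, x <> y) & continuous f].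

(* A gap function maps N x (0, +oo) to N, where N is the set of positive
   integers; the values of M outside that domain are irrelevant. *)
Definition gap_function M :=
  [/\ forall n e, (0 < n)%N -> 0 < e -> (0 < M n e)%N,
      forall m n e, (0 < m)%N -> (m <= n)%N -> 0 < e -> (M m e <= M n e)%N
    & forall n e1 e2, (0 < n)%N -> 0 < e1 -> e1 <= e2 -> (M n e2 <= M n e1)%N].

Definition nonuniform_specification f M :=
  gap_function M /\
  forall (e : R) (k : nat) (x : 'I_k -> X) (a b : 'I_k -> nat),
    0 < e -> (2 <= k)%N ->
    (forall i, (a i <= b i)%N) ->
    (forall i j : 'I_k, j = i.+1 :> nat ->
       (b i < a j)%N /\ (M (b i - a i).+1 e <= a j - b i)%N) ->
    exists z : X, forall (i : 'I_k) (n : nat), (a i <= n <= b i)%N ->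
      mdist (iter (n - a i) f (x i)) (iter n f z) <= e.

Definition gap_functions f : set (nat -> R -> nat) :=
  [set M | nonuniform_specification f M].

Definition gap_tau M : \bar R :=
  ereal_sup [set limn_einf (fun n => ((M n e)%:R / n%:R)%:E) | e in [set e | 0 < e]].

Definition nonuniform_tau_specification f (tau : R) :=
  (exists2 M, gap_functions f M & gap_tau M = tau%:E) /\
  (forall M', gap_functions f M' -> (tau%:E <= gap_tau M')%E).

Definition invariant_measure f (mu : probability (borel X) R) :=
  forall A : set (borel X), measurable A -> mu (f @^-1` A) = mu A.

Definition ergodic_measure f (mu : probability (borel X) R) :=
  invariant_measure f mu /\
  forall A : set (borel X), measurable A -> f @^-1` A = A ->
    mu A = 0%E \/ mu A = 1%E.

Section EmpiricalMeasure.
Variables (f : X -> X) (x : X) (n : nat).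

(* The average of the Dirac masses at the first n.+1 points of the orbit; the
   index is shifted so that the measure is always a probability. *)
Definition empirical : set (borel X) -> \bar R :=
  mscale ((n.+1%:R : R)^-1)%:nng (msum (fun k => \d_(iter k f x : borel X)) n.+1).

HB.instance Definition _ := Measure.on empirical.

Let empirical_setT : empirical setT = 1%E.
Proof.
rewrite /empirical /mscale /= /msum (eq_bigr (fun=> 1%E)) => [|i _].
  by rewrite sumEFin -EFinM big_const_ord iter_addr addr0 mulVf.
exact: diracT.
Qed.

HB.instance Definition _ :=
  Measure_isProbability.Build _ _ _ empirical empirical_setT.

End EmpiricalMeasure.

(* The weak* topology on Borel probability measures is the initial one for the
   maps mu |-> \int phi dmu, with phi ranging over the continuous functions. *)
Definition integrate_continuous (mu : probability (borel X) R) :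
    {ptws continuousType X R -> R} :=
  fun phi => \int[mu]_x phi x.

Definition weak_star := initial_topology integrate_continuous.

(* Accumulation points of the sequence of empirical measures, not of its range:
   the limit of an eventually constant sequence is one. *)
Definition empirical_limits f x : set weak_star :=
  cluster ((fun n => (empirical f x n : probability (borel X) R) : weak_star)
             @ \oo).

Definition generic_limit_set f (mu : probability (borel X) R) : set X :=
  [set x | empirical_limits f x mu].

Definition omega_limit f x : set X := cluster ((fun n => iter n f x) @ \oo).

Definition transitive_points f : set X := [set x | omega_limit f x = setT].

(* At n = 0 the quotient is 0, which does not affect the limits. *)
Definition close_frequency f x y (t : R) (n : nat) : \bar R :=
  (#|[pred j : 'I_n | mdist (iter j f x) (iter j f y) < t]|%:R / n%:R)%:E.

Definition DC1_pair f x y :=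
  (forall t : R, 0 < t -> limn_esup (close_frequency f x y t) = 1%E) /\
  (exists2 t0 : R, 0 < t0 & limn_einf (close_frequency f x y t0) = 0%E).

Definition DC1_scrambled f (S : set X) :=
  forall x y, S x -> S y -> x <> y -> DC1_pair f x y.

End DynamicalSystems.

(* Main.v *)
(** Birkhoff's theorem gives an orbit generic for [mu] and, since [mu] and [nu]
    are distinct and ergodic, a continuous [psi] with values in [0, 1] whose
    [mu]-integral exceeds 1/2 and whose [nu]-integral is as small as we please.
    Choose [D] such that, at every scale, arbitrarily large lengths [n] have a
    gap of at most [D n].  Shadowing periodically a block that starts near one
    of two distinct points and then follows the generic orbit yields two points
    that stay uniformly apart and whose [psi]-averages are bounded below.

    A point of the scrambled set is built in stages.  Stage [k] keeps the orbit
    constructed so far, visits a point of a dense sequence, and then follows for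
    a time dominating all previous ones either the generic orbit or one of the
    two separated orbits, according to a bit of a sequence [xi].  Every bit is
    read infinitely often.  A gap is at most a fixed multiple of the time already
    elapsed, so the [psi]-averages stay above a positive constant at all times,
    which excludes [nu] as an accumulation point of the empirical measures. *)

Require Import Defs.
From mathcomp Require Import lra zify measurable_realfun archimedean.

Set Implicit Arguments.
Unset Strict Implicit.
Unset Printing Implicit Defensive.

Local Open Scope classical_set_scope.
Local Open Scope ring_scope.

(** * The maximal inequality and Birkhoff's theorem for ergodic maps *)

Section Birkhoff.
Context {d} {T : measurableType d} {R : realType} (P : probability T R).
Implicit Types (f : T -> T) (phi psi : T -> R).

Definition bounded_measurable phi :=
  measurable_fun setT phi /\ exists B, forall x, `|phi x| <= B.

Lemma bounded_measurable_integrable phi :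
  bounded_measurable phi -> P.-integrable setT (EFin \o phi).
Proof.
move=> [mphi [B phiB]]; apply: measurable_bounded_integrable => //.
  by rewrite (le_lt_trans (probability_le1 P measurableT))// ltry.
by exists B; split; rewrite ?num_real// => M BM x _ /=; rewrite (le_trans (phiB x))// ltW.
Qed.

Lemma bounded_measurable_cst r : bounded_measurable (cst r).
Proof. by split => //; exists `|r|. Qed.

Lemma bounded_measurableD phi psi : bounded_measurable phi ->
  bounded_measurable psi -> bounded_measurable (fun x => phi x + psi x).
Proof.
move=> [mp [B pB]] [mq [C qC]]; split; first exact: measurable_funD.
by exists (B + C) => x; rewrite (le_trans (ler_normD _ _))// lerD.
Qed.

Lemma bounded_measurableN phi : bounded_measurable phi ->
  bounded_measurable (fun x => - phi x).
Proof.
move=> [mp [B pB]]; split; first exact: measurableT_comp.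
by exists B => x; rewrite normrN.
Qed.

Lemma bounded_measurableM phi psi : bounded_measurable phi ->
  bounded_measurable psi -> bounded_measurable (fun x => phi x * psi x).
Proof.
move=> [mp [B pB]] [mq [C qC]]; split; first exact: measurable_funM.
by exists (B * C) => x; rewrite normrM ler_pM.
Qed.

Lemma bounded_measurable_max phi psi : bounded_measurable phi ->
  bounded_measurable psi -> bounded_measurable (fun x => Num.max (phi x) (psi x)).
Proof.
move=> [mp [B pB]] [mq [C qC]]; split; first exact: measurable_maxr.
exists (B + C) => x; have := pB x; have := qC x.
rewrite !ler_norml => /andP[h1 h2] /andP[h3 h4].
have [_|_] := leP (phi x) (psi x); lra.
Qed.

Lemma bounded_measurable_indic (A : set T) : measurable A ->
  bounded_measurable (\1_A : T -> R).
Proof.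
move=> mA; split; first exact: measurable_indic.
by exists 1 => x; rewrite indicE ger0_norm// lern1 leq_b1.
Qed.

Lemma bounded_measurable_comp f phi : measurable_fun setT f ->
  bounded_measurable phi -> bounded_measurable (phi \o f).
Proof.
move=> mf [mp [B pB]]; split; first exact: measurableT_comp.
by exists B => x; exact: pB.
Qed.

Lemma bounded_measurable_sum (I : Type) (r : seq I) (F : I -> T -> R) :
  (forall i, bounded_measurable (F i)) ->
  bounded_measurable (fun x => \sum_(i <- r) F i x).
Proof.
move=> bF; elim: r => [|i r IH].
  under eq_fun do rewrite big_nil.
  exact: bounded_measurable_cst.
under eq_fun do rewrite big_cons.
exact: bounded_measurableD.
Qed.

Lemma bounded_measurable_iter f n phi : measurable_fun setT f ->
  bounded_measurable phi -> bounded_measurable (phi \o iter n f).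
Proof.
move=> mf bp; elim: n => [//|n IH].
rewrite (_ : _ \o _ = (phi \o iter n f) \o f); last first.
  by apply/funext => x; rewrite /= -iterSr.
exact: bounded_measurable_comp.
Qed.

Lemma Rintegral_sum (I : Type) (r : seq I) (F : I -> T -> R) :
  (forall i, bounded_measurable (F i)) ->
  \int[P]_x (\sum_(i <- r) F i x) = \sum_(i <- r) \int[P]_x F i x.
Proof.
move=> bF; elim: r => [|i r IH].
  by under eq_Rintegral do rewrite big_nil; rewrite Rintegral_cst// mul0r big_nil.
under eq_Rintegral do rewrite big_cons.
rewrite RintegralD//; first by rewrite IH big_cons.
  exact: bounded_measurable_integrable.
by apply: bounded_measurable_integrable; exact: bounded_measurable_sum.
Qed.

Definition orbit_sum (U : Type) (g : U -> U) (phi : U -> R) (n : nat) (x : U) :=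
  \sum_(i < n) phi (iter i g x).

Lemma orbit_sumS (U : Type) (g : U -> U) (phi : U -> R) n x :
  orbit_sum g phi n.+1 x = phi x + orbit_sum g phi n (g x).
Proof.
rewrite /orbit_sum big_ord_recl; congr (_ + _).
by apply: eq_bigr => i _; rewrite /bump /= -iterSr.
Qed.

Lemma orbit_sumD (U : Type) (g : U -> U) (phi : U -> R) m n x :
  orbit_sum g phi (m + n) x = orbit_sum g phi m x + orbit_sum g phi n (iter m g x).
Proof.
elim: m x => [|m IH] x; first by rewrite /orbit_sum big_ord0 add0r.
by rewrite addSn !orbit_sumS IH addrA -iterSr.
Qed.

Lemma bounded_measurable_orbit_sum f phi n : measurable_fun setT f ->
  bounded_measurable phi -> bounded_measurable (orbit_sum f phi n).
Proof.
by move=> mf bp; apply: bounded_measurable_sum => i; exact: bounded_measurable_iter.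
Qed.

Definition preserves f := forall A, measurable A -> P (f @^-1` A) = P A.

Lemma preserves_Rintegral f phi : measurable_fun setT f -> preserves f ->
  bounded_measurable phi -> \int[P]_x phi (f x) = \int[P]_x phi x.
Proof.
move=> mf pf bp; rewrite /Rintegral; congr fine.
transitivity (\int[pushforward P f]_x (phi x)%:E)%E.
  rewrite (@integral_pushforward _ _ _ _ _ f mf P setT (EFin \o phi))//.
    by apply/measurable_EFinP; case: bp.
  exact: (bounded_measurable_integrable (bounded_measurable_comp mf bp)).
by apply: eq_measure_integral => A mA _; exact: pf.
Qed.

(** The maximum of the orbit sums of lengths 0 to [n], written as a recursion from [x] to [f x]
    because the maximal inequality compares these two points. *)
Fixpoint running_max f phi n x : R :=
  if n is n'.+1 then Num.max 0 (phi x + running_max f phi n' (f x)) else 0.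

Lemma running_max_ge0 f phi n x : 0 <= running_max f phi n x.
Proof. by case: n => //= n; rewrite le_max lexx. Qed.

Lemma running_max_le f phi n x : running_max f phi n x <= running_max f phi n.+1 x.
Proof.
elim: n x => [|n IH] x /=; first by rewrite le_max lexx.
apply: le_max2 => //; rewrite lerD2l; exact: IH.
Qed.

Lemma orbit_sum_le_running_max f phi n x :
  orbit_sum f phi n x <= running_max f phi n x.
Proof.
elim: n x => [|n IH] x; first by rewrite /orbit_sum big_ord0.
by rewrite orbit_sumS /= le_max lerD2l IH orbT.
Qed.

Lemma bounded_measurable_running_max f phi n : measurable_fun setT f ->
  bounded_measurable phi -> bounded_measurable (running_max f phi n).
Proof.
move=> mf bp; elim: n => [|n IH] /=; first exact: (bounded_measurable_cst 0).
apply: bounded_measurable_max; first exact: (bounded_measurable_cst 0).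
by apply: bounded_measurableD => //; exact: (bounded_measurable_comp mf IH).
Qed.

Lemma measurable_le_cst phi r : measurable_fun setT phi ->
  measurable [set x | phi x <= r].
Proof.
move=> mp; rewrite (_ : mkset _ = setT `&` phi @^-1` `]-oo, r]); first exact: mp.
by apply/seteqP; split => x /=; rewrite in_itv/=; [split|case].
Qed.

(** Garsia's argument. Where the running maximum is positive, it is [phi x] plus a shorter running
    maximum at [f x], so [phi] dominates the difference of the running maxima at [x] and [f x]; on
    the remaining set [phi + B] does. By invariance that difference has integral 0. *)
Lemma maximal_inequality f phi B n : measurable_fun setT f -> preserves f ->
  measurable_fun setT phi -> (forall x, `|phi x| <= B) ->
  0 <= \int[P]_x phi x + B * fine (P [set x | running_max f phi n x <= 0]).
Proof.
move=> mf pf mp pB; set F := [set x | _].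
have bp : bounded_measurable phi by split => //; exists B.
have bM := bounded_measurable_running_max n mf bp.
have mF : measurable F by apply: measurable_le_cst; case: bM.
have bI : bounded_measurable (fun x => B * \1_F x).
  apply: bounded_measurableM; first exact: bounded_measurable_cst.
  exact: bounded_measurable_indic.
have -> : B * fine (P F) = \int[P]_x (B * \1_F x).
  rewrite RintegralZl//; last first.
    by apply: bounded_measurable_integrable; exact: bounded_measurable_indic.
  by rewrite /Rintegral integral_indic// setIT.
rewrite -RintegralD//; [|exact: bounded_measurable_integrable..].
have bMf := bounded_measurable_comp mf bM.
have -> : 0 = \int[P]_x (running_max f phi n x + - running_max f phi n (f x)).
  rewrite RintegralB//; [|exact: bounded_measurable_integrable..].
  by rewrite preserves_Rintegral// subrr.
apply: le_Rintegral => //.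
- apply: bounded_measurable_integrable; apply: bounded_measurableD => //.
  exact: bounded_measurableN.
- by apply: bounded_measurable_integrable; exact: bounded_measurableD.
move=> x _; rewrite indicE.
have := running_max_ge0 f phi n (f x); have := pB x; rewrite ler_norml => /andP[p1 p2].
have [xF|xF] := boolP (x \in F).
  by move: xF; rewrite inE /F/= => xF; lra.
move: xF; rewrite notin_setE/= => /negP; rewrite -ltNge.
case: n {F mF bI bM bMf} => [|n] /=; first by rewrite ltxx.
rewrite lt_max ltxx/= => h.
rewrite (max_r (ltW h)).
have := running_max_le f phi n (f x).
rewrite [running_max f phi n.+1 (f x)]/=; lra.
Qed.

(** The running maximum dominates the orbit sums, so the sets where it is at most 0 decrease to a
    null set, and the error term of the maximal inequality tends to 0. *)
Lemma integral_ge0_of_orbit_sum f phi : measurable_fun setT f -> preserves f ->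
  bounded_measurable phi ->
  P (\bigcap_n [set x | orbit_sum f phi n x <= 0]) = 0%E ->
  0 <= \int[P]_x phi x.
Proof.
move=> mf pf bp P0; have [mp [B pB]] := bp.
pose F n := [set x | running_max f phi n x <= 0].
have mF n : measurable (F n).
  by apply: measurable_le_cst; case: (bounded_measurable_running_max n mf bp).
have mG n : measurable [set x | orbit_sum f phi n x <= 0].
  by apply: measurable_le_cst; case: (bounded_measurable_orbit_sum n mf bp).
have F0 : P (\bigcap_n F n) = 0%E.
  apply: (subset_measure0 _ _ _ P0); [exact: bigcapT_measurable..|].
  by move=> x Fx n _; exact: le_trans (orbit_sum_le_running_max f phi n x) (Fx n I).
have cvF : P \o F @ \oo --> 0%E.
  rewrite -F0; apply: nonincreasing_cvg_mu => //.
  - by rewrite (le_lt_trans (probability_le1 P (mF _)))// ltry.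
  - exact: bigcapT_measurable.
  - apply/nonincreasing_seqP => n; apply/subsetPset => x; apply: le_trans.
    exact: running_max_le.
have cvB : (\int[P]_x phi x + B * fine (P (F n)) @[n --> \oo] --> \int[P]_x phi x)%R.
  rewrite -[X in _ --> X]addr0 -(mulr0 B); apply: cvgD; first exact: cvg_cst.
  by apply: cvgM; [exact: cvg_cst|exact: fine_cvg cvF].
rewrite -(cvg_lim _ cvB)//; apply: limr_ge; first by apply/cvg_ex; eexists; exact: cvB.
by apply: nearW => n; exact: maximal_inequality.
Qed.

Definition ergodic f := preserves f /\ forall A, measurable A ->
  f @^-1` A = A -> P A = 0%E \/ P A = 1%E.

Lemma orbit_sumBl (U : Type) (g : U -> U) (phi : U -> R) c n x :
  orbit_sum g (fun y => phi y - c) n x = orbit_sum g phi n x - c * n%:R.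
Proof.
by rewrite /orbit_sum big_split/= sumrN sumr_const card_ord mulr_natr.
Qed.

(* Unboundedness from above of S_n - c n, unlike limsup S_n / n > c, is
   invariant by a direct computation. *)
Lemma ergodic_orbit_sum_le f phi c : measurable_fun setT f -> ergodic f ->
  bounded_measurable phi -> \int[P]_x phi x < c ->
  {ae P, forall x, exists K : nat, forall n, orbit_sum f phi n x <= c * n%:R + K%:R}.
Proof.
move=> mf [pf ef] bp pc.
pose psi := fun y => phi y - c.
have bpsi : bounded_measurable psi.
  by apply: bounded_measurableD => //; exact: bounded_measurable_cst.
pose F (K n : nat) := [set x | orbit_sum f psi n x <= K%:R].
have mF K n : measurable (F K n).
  by apply: measurable_le_cst; case: (bounded_measurable_orbit_sum n mf bpsi).
pose G := \bigcup_K \bigcap_n F K n.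
have mG : measurable G.
  by apply: bigcupT_measurable => K; exact: bigcapT_measurable.
have [B psiB] : exists B : nat, forall x, `|psi x| <= B%:R.
  have [_ [B psiB]] := bpsi; exists (Num.trunc B).+1 => x.
  by rewrite (le_trans (psiB x))// ltW// truncnS_gt.
(* Orbit sums at [x] and at [f x] differ by one value of [psi], so passing from one point to the
   other only replaces [K] by [K + B]. *)
have GI : f @^-1` G = G.
  apply/seteqP; split => x [K _ FK]; exists (K + B)%N => // -[|n] _.
  - by rewrite /F/= /orbit_sum big_ord0.
  - rewrite /F/= orbit_sumS natrD addrC lerD//; first exact: FK n I.
    exact: le_trans (ler_norm _) (psiB x).
  - by rewrite /F/= /orbit_sum big_ord0.
  - rewrite /F/=; have := FK n.+2 I; rewrite /F/= orbit_sumS natrD => h.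
    by have := psiB x; rewrite ler_norml => /andP[h1 _]; lra.
suff PG : P G = 1%E.
  exists (~` G); split; first exact: measurableC.
    by rewrite probability_setC// PG subee.
  move=> x/= Nx [K _ FK]; apply: Nx; exists K => n.
  have := FK n I; rewrite /F/= orbit_sumBl; lra.
(* If [G] were null, so would be its part with [K = 0], and [psi] would have a nonnegative integral,
   contrary to the choice of [c]. *)
have [PG0|//] := ef _ mG GI.
have : 0 <= \int[P]_x psi x.
  apply: (integral_ge0_of_orbit_sum mf pf bpsi).
  apply: (subset_measure0 _ mG _ PG0); last by move=> x Fx; exists 0%N.
  by apply: bigcapT_measurable => n; exact: (mF 0%N n).
rewrite RintegralB//; [|exact: bounded_measurable_integrable|]; last first.
  by apply: bounded_measurable_integrable; exact: bounded_measurable_cst.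
by rewrite Rintegral_cst// [X in fine X](probability_setT P)/= mulr1 subr_ge0 leNgt pc.
Qed.

(** The linear upper bounds for [phi] and for its opposite hold almost everywhere for all slopes
    1/(m+1) above the mean at once; division by [n] removes the additive constants. *)
Theorem birkhoff_ergodic f phi : measurable_fun setT f -> ergodic f ->
  bounded_measurable phi ->
  {ae P, forall x, orbit_sum f phi n x / n%:R @[n --> \oo] --> \int[P]_x phi x}.
Proof.
move=> mf ef bp; set I := \int[P]_x phi x.
have bpN := bounded_measurableN bp.
have IN : \int[P]_x - phi x = - I.
  rewrite -mulN1r -RintegralZl//; last exact: bounded_measurable_integrable.
  by apply: eq_Rintegral => x _; rewrite mulN1r.
have e0 (m : nat) : 0 < (m.+1%:R : R)^-1 by rewrite invr_gt0.
have /ae_foralln : forall m : nat, \forall x \ae P, exists K : nat, forall n,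
    orbit_sum f phi n x <= (I + m.+1%:R^-1) * n%:R + K%:R.
  by move=> m; apply: ergodic_orbit_sum_le => //; rewrite ltrDl.
have /ae_foralln : forall m : nat, \forall x \ae P, exists K : nat, forall n,
    orbit_sum f (fun x => - phi x) n x <= (- I + m.+1%:R^-1) * n%:R + K%:R.
  by move=> m; apply: ergodic_orbit_sum_le => //; rewrite IN ltrDl.
apply: filterS2 => x h1 h2; apply/cvgrPdist_le => /= e e_gt0.
have [m me] : exists m : nat, m.+1%:R^-1 <= e / 2.
  exists (Num.trunc (e / 2)^-1); rewrite invf_ple ?posrE ?divr_gt0//.
  by rewrite ltW// truncnS_gt.
have [K1 {}h1] := h1 m; have [K2 {}h2] := h2 m.
pose N := (Num.trunc ((K1 + K2)%:R * (e / 2)^-1)).+1.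
near=> n.
have nN : (N <= n)%N by near: n; exists N.
have n0 : 0 < n%:R :> R by rewrite ltr0n (leq_trans _ nN).
have Kn : (K1 + K2)%:R <= (e / 2) * n%:R.
  rewrite mulrC -ler_pdivrMr ?divr_gt0//.
  by rewrite (le_trans (ltW (truncnS_gt _)))// ler_nat.
have := h1 n; have := h2 n.
rewrite {2}/orbit_sum sumrN -/(orbit_sum f phi n x) => s1 s2.
rewrite natrD in Kn.
have me' : m.+1%:R^-1 * n%:R <= e / 2 * n%:R by rewrite ler_pM2r.
have K1n : 0 <= K1%:R :> R by []. have K2n : 0 <= K2%:R :> R by [].
rewrite distrC ler_distl ler_pdivlMr// ler_pdivrMr//.
move: s1 s2 Kn me' K1n K2n.
move: (orbit_sum f phi n x) (m.+1%:R^-1 : R) (n%:R : R) (K1%:R : R) (K2%:R : R).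
move=> S a n' k1 k2 *; apply/andP; split; lra.
Unshelve. all: by end_near. Qed.

End Birkhoff.

(** * Continuous functions on a compact metric space and generic points *)

Section CompactMetric.
Context {R : realType} {X : pmetricType R}.
Implicit Types (f : X -> X) (phi : X -> R) (x y : X).

Lemma mdist_lipschitz (a x y : X) : `|mdist a x - mdist a y| <= mdist x y.
Proof.
have h1 := metric_triangle a x y; have h2 := metric_triangle a y x.
rewrite (metric_sym y x) in h2.
rewrite ler_norml; apply/andP; split; lra.
Qed.

Lemma nbhs_mdist x (e : R) : 0 < e -> nbhs x [set y | mdist x y < e].
Proof. by move=> e0; rewrite -ballEmdist; exact: nbhsx_ballx. Qed.

Lemma continuous_mdist a : continuous (mdist a : X -> R).
Proof.
move=> x; apply/cvgrPdist_lt => e e0; near=> y.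
apply: le_lt_trans (mdist_lipschitz _ _ _) _.
by near: y; exact: nbhs_mdist.
Unshelve. all: by end_near. Qed.

Lemma open_mdist a (e : R) : open [set y : X | mdist a y < e].
Proof.
rewrite (_ : mkset _ = (mdist a : X -> R) @^-1` [set r | r < e])//.
by apply: open_comp; [move=> x _; exact: continuous_mdist|exact: open_lt].
Qed.

Lemma closed_mdist_le f a (e : R) : continuous f ->
  closed [set y : X | mdist a (f y) <= e].
Proof.
move=> cf; rewrite (_ : mkset _ = ((mdist a : X -> R) \o f) @^-1` [set r | r <= e])//.
apply: closed_comp; last exact: closed_le.
by move=> x _; apply: continuous_comp; [exact: cf|exact: continuous_mdist].
Qed.

Lemma continuous_iter f n : continuous f -> continuous (iter n f).
Proof.
move=> cf; elim: n => [|n IH] x /=; first exact: cvg_id.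
by apply: (@continuous_comp _ _ _ (iter n f) f); [exact: IH|exact: cf].
Qed.

(** Closed conditions that hold eventually along [u] pass to a cluster point, so limits of shadowing
    points need no subsequence. *)
Lemma compact_cluster (u : nat -> X) : compact [set: X] ->
  exists z, forall A : set X, closed A -> (\forall n \near \oo, A (u n)) -> A z.
Proof.
move=> cX; have [|z [_ zu]] := cX (u @ \oo) _; first exact: filterT.
by exists z => A cA Au; apply: cA => B Bz; exact: zu.
Qed.

(** The near-covering form of compactness reduces the claim to a local one; half of the local radius
    is kept for moving the base point. *)
Lemma compact_uniform_continuous (V : pseudoMetricType R) (g : X -> V) :
  compact [set: X] -> continuous g -> forall e, 0 < e ->
  exists2 r, 0 < r & forall x y, mdist x y < r -> ball (g x) e (g y).
Proof.
move=> /compact_near_coveringP cX cg e e0.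
have e20 : 0 < e / 2 by rewrite divr_gt0.
have : \forall r \near 0^'+,
    [set: X] `<=` [set x | forall y, mdist x y < r -> ball (g x) e (g y)].
  apply: cX => x _.
  have /cg : nbhs (g x) (ball (g x) (e / 2)) by exact: nbhsx_ballx.
  move/nbhs_ballP => [d /= d0]; rewrite ballEmdist => dx.
  exists ([set y | mdist x y < d / 2], [set r | r < d / 2]) => /=.
    split; first by apply: nbhs_mdist; rewrite divr_gt0.
    by apply: nbhs_right_lt; rewrite divr_gt0.
  move=> [x' r] /= [xx' rd] y xy.
  rewrite (splitr e); apply: ball_triangle (dx y _); last first.
    by rewrite /= (le_lt_trans (metric_triangle x x' y))//; lra.
  by apply/ball_sym/dx; rewrite /=; lra.
move=> H; have [r [r0 rP]] : exists r : R, 0 < r /\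
    [set: X] `<=` [set x | forall y, mdist x y < r -> ball (g x) e (g y)].
  apply: (@filter_ex _ (0^'+ : set_system R)).
  by apply: filterI H; exact: nbhs_right_gt.
by exists r => // x y; exact: rP.
Qed.

Lemma compact_continuous_bounded phi : compact [set: X] -> continuous phi ->
  exists B, forall x, `|phi x| <= B.
Proof.
move=> cX cphi.
have [M [_ hM]] := compact_bounded (continuous_compact (continuous_subspaceT cphi) cX).
by exists (M + 1) => x; apply: hM; [rewrite ltrDl|exists x].
Qed.

(** Finite 1/(m+1)-nets are merged into one sequence by coding the pairs of a level and a position.
    The bound [V] is uniform in [x], which is more than density. *)
Lemma compact_dense_sequence : compact [set: X] ->
  exists y : nat -> X, forall e : R, 0 < e ->
    exists V, forall x, exists2 v, (v < V)%N & mdist (y v) x < e.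
Proof.
move=> cX.
have net (m : nat) : exists s : seq X, forall x, exists2 y, y \in s & mdist y x < m.+1%:R^-1.
  move: cX; rewrite compact_cover.
  case/(_ X setT (fun y => [set x | mdist y x < m.+1%:R^-1])).
  - by move=> y _; exact: open_mdist.
  - by move=> x _; exists x => //=; rewrite mdistxx invr_gt0.
  move=> D _ cD; exists (finmap.enum_fset D) => x.
  by have [y yD xy] := cD x I; exists y.
have [s sP] := choice net.
exists (fun v => if unpickle v is Some (m, i) then nth point (s m) i else point) => e e0.
pose m := Num.trunc e^-1.
have me : m.+1%:R^-1 <= e by rewrite invf_ple ?posrE// ltW// truncnS_gt.
exists (\max_(i < size (s m)) pickle (m, val i)).+1 => x.
have [y ys yx] := sP m x; exists (pickle (m, index y (s m))).
  have h : (index y (s m) < size (s m))%N by rewrite index_mem.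
  by rewrite ltnS (@leq_bigmax _ (fun i : 'I_(size (s m)) => pickle (m, val i)) (Ordinal h)).
by rewrite pickleK nth_index// (lt_le_trans yx).
Qed.

Lemma measurable_borel_continuous f : continuous f ->
  measurable_fun setT (f : borel X -> borel X).
Proof.
move=> /continuousP cf; apply: (measurability _ (erefl : @measurable _ (borel X) = <<s @open X >>)).
move=> _ [B oB <-]; rewrite setTI; apply: sub_sigma_algebra; exact: cf.
Qed.

Lemma measurable_borel_continuous_real phi : continuous phi ->
  measurable_fun setT (phi : borel X -> R).
Proof.
move=> /continuousP cphi; apply: (measurability _ (RGenOpens.measurableE R)).
move=> _ [_ [a [b ->] <-]]; rewrite setTI; apply: sub_sigma_algebra; apply: cphi.
exact: interval_open.
Qed.

Lemma bounded_measurable_continuous phi : compact [set: X] -> continuous phi ->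
  bounded_measurable (phi : borel X -> R).
Proof.
move=> cX cphi; split; first exact: measurable_borel_continuous_real.
exact: compact_continuous_bounded.
Qed.

Lemma continuous_orbit_sum f phi n : continuous f -> continuous phi ->
  continuous (orbit_sum f phi n).
Proof.
move=> cf cphi; elim: n => [|n IH] x.
  rewrite (_ : orbit_sum f phi 0 = cst 0); first exact: cvg_cst.
  by apply/funext => y; rewrite /orbit_sum big_ord0.
rewrite (_ : orbit_sum f phi n.+1 = orbit_sum f phi n \+ (phi \o iter n f)).
  apply: cvgD; first exact: IH.
  by apply: (@continuous_comp _ _ _ (iter n f) phi); [exact: continuous_iter|exact: cphi].
by apply/funext => y; rewrite /orbit_sum big_ord_recr.
Qed.

Lemma ae_exists (mu : probability (borel X) R) (Q : borel X -> Prop) :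
  (\forall x \ae mu, Q x) -> exists x, Q x.
Proof.
have mu_gt0 : (0 < mu setT)%E by rewrite probability_setT.
have ? := ae_properfilter_algebraOfSetsType mu_gt0.
exact: filter_ex.
Qed.

Definition generic_point f (mu : probability (borel X) R) x :=
  forall phi, continuous phi ->
    orbit_sum f phi n x / n%:R @[n --> \oo] --> \int[mu]_x phi x.

Lemma le_Rintegral_dist (mu : probability (borel X) R) (phi psi : borel X -> R) e :
  bounded_measurable phi -> bounded_measurable psi ->
  (forall x, `|phi x - psi x| <= e) ->
  `|\int[mu]_x phi x - \int[mu]_x psi x| <= e.
Proof.
move=> bp bq pq.
have bd : bounded_measurable (fun x : borel X => phi x - psi x).
  by apply: bounded_measurableD => //; exact: bounded_measurableN.
rewrite -RintegralB//; [|exact: bounded_measurable_integrable..].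
apply: le_trans (le_normr_Rintegral _ _) _ => //.
  exact: bounded_measurable_integrable.
rewrite -[leRHS]mulr1 -[X in _ * X]/(fine 1%E) -(probability_setT mu) -Rintegral_cst//.
apply: le_Rintegral => //.
  by apply: integrable_norm; exact: bounded_measurable_integrable.
by apply: bounded_measurable_integrable; exact: bounded_measurable_cst.
Qed.

Lemma le_orbit_sum_dist f (phi psi : X -> R) e n x :
  (forall x, `|phi x - psi x| <= e) ->
  `|orbit_sum f phi n x - orbit_sum f psi n x| <= e * n%:R.
Proof.
move=> pq; rewrite /orbit_sum -sumrB (le_trans (ler_norm_sum _ _ _))//.
rewrite mulr_natr -[n in leRHS]card_ord -sumr_const.
by apply: ler_sum => i _; exact: pq.
Qed.

(* A continuous function is uniformly approximated by step functions on the
   sets of points whose first 1/(m+1)-close term of a dense sequence has a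
   given index, and there are countably many such sets. *)
Lemma ergodic_generic_point f (mu : probability (borel X) R) :
  compact [set: X] -> continuous f -> ergodic_measure f mu ->
  exists x, generic_point f mu x.
Proof.
move=> cX cf ef; have [y yP] := compact_dense_sequence cX.
pose A (m v : nat) : set X := [set x | mdist (y v) x < m.+1%:R^-1 /\
  forall u, (u < v)%N -> ~ mdist (y u) x < m.+1%:R^-1].
have mA m v : measurable (A m v : set (borel X)).
  have mball u : measurable ([set x | mdist (y u) x < m.+1%:R^-1] : set (borel X)).
    by apply: sub_sigma_algebra; exact: open_mdist.
  rewrite (_ : A m v = [set x | mdist (y v) x < m.+1%:R^-1] `\`
     \bigcup_(u in [set u | (u < v)%N]) [set x | mdist (y u) x < m.+1%:R^-1]).
    by apply: measurableD => //; apply: bigcup_measurable => u _; exact: mball.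
  apply/seteqP; split=> [x [vx ux]|x [vx ux]]; split=> //.
    by move=> [u /= uv]; exact: ux.
  by move=> u uv yux; apply: ux; exists u.
have mf := measurable_borel_continuous cf.
have bA m v := bounded_measurable_indic (mA m v) : bounded_measurable (\1_(A m v) : borel X -> R).
have : \forall x \ae mu, forall m v,
    orbit_sum f (\1_(A m v) : borel X -> R) n x / n%:R @[n --> \oo] -->
    \int[mu]_x (\1_(A m v) : borel X -> R) x.
  apply: ae_foralln => m; apply: ae_foralln => v.
  by apply: birkhoff_ergodic => //; exact: bA.
move=> /ae_exists[g gA]; exists g => phi cphi.
apply/cvgrPdist_le => /= e e0; have e30 : 0 < e / 3 by rewrite divr_gt0.
have [r r0 rP] := compact_uniform_continuous cX cphi e30.
pose m := Num.trunc r^-1.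
have mr : m.+1%:R^-1 <= r by rewrite invf_ple ?posrE// ltW// truncnS_gt.
have [V VP] := yP m.+1%:R^-1 ltac:(by rewrite invr_gt0).
(* The sets [A m v] are disjoint and those with [v < V] cover the space, so [psi] takes at [x] the
   value of [phi] at the first term close to [x]. The error [e / 3] is spent on the integrals, on
   the averages, and on the convergence for [psi]. *)
pose psi (x : borel X) : R := \sum_(v < V) phi (y v) * \1_(A m v) x.
have bpA (v : 'I_V) : bounded_measurable (fun x : borel X => phi (y v) * \1_(A m v) x).
  by apply: bounded_measurableM => //; exact: bounded_measurable_cst.
have intZ v : \int[mu]_x (phi (y v) * (\1_(A m v) : borel X -> R) x) =
    phi (y v) * \int[mu]_x (\1_(A m v) : borel X -> R) x.
  by rewrite RintegralZl//; apply: bounded_measurable_integrable; exact: bA.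
have bpsi : bounded_measurable psi by exact: bounded_measurable_sum.
have bphi := bounded_measurable_continuous cX cphi.
have phipsi x : `|phi x - psi x| <= e / 3.
  have exv : exists v, (v < V)%N && (mdist (y v) x < m.+1%:R^-1).
    by have [v vV yv] := VP x; exists v; rewrite vV.
  have [v /andP[vV yvx] vmin] := ex_minnP exv.
  have Av : A m v x.
    split => // u uv yux; have := vmin u; rewrite yux (ltn_trans uv vV)/= => /(_ isT).
    by rewrite leqNgt uv.
  rewrite /psi (bigD1 (Ordinal vV))//= indicE mem_set//= mulr1 big1 ?addr0.
    have := rP (y v) x (lt_le_trans yvx mr).
    by rewrite -ball_normE/= distrC => /ltW.
  move=> w wv; rewrite indicE memNset ?mulr0// => -[ywx ywmin].
  have [vw|wv'] := ltnP v w; first exact: ywmin vw yvx.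
  have := vmin w; rewrite ywx (ltn_ord w) => /(_ isT) vw.
  by move/eqP: wv; apply; apply/val_inj/eqP; rewrite eqn_leq wv' vw.
have cpsi : orbit_sum f psi n g / n%:R @[n --> \oo] --> \int[mu]_x psi x.
  rewrite Rintegral_sum//.
  under eq_fun => n.
    rewrite /orbit_sum exchange_big/= mulr_suml.
    under eq_bigr do rewrite -mulr_sumr -mulrA.
    over.
  under eq_bigr do rewrite intZ.
  apply: cvg_big => [|v _]; first exact: add_continuous.
  by apply: cvgM; [exact: cvg_cst|exact: gA].
have int_close := le_Rintegral_dist mu bphi bpsi phipsi.
near=> n.
have n0 : 0 < n%:R :> R by rewrite ltr0n; near: n; exists 1%N.
have sum_close := le_orbit_sum_dist f n g phipsi.
have avg_close : `|orbit_sum f phi n g / n%:R - orbit_sum f psi n g / n%:R| <= e / 3.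
  by rewrite -mulrBl normrM [X in _ * X]gtr0_norm ?invr_gt0// ler_pdivrMr.
have : `|\int[mu]_x psi x - orbit_sum f psi n g / n%:R| <= e / 3.
  by near: n; move/cvgrPdist_le : cpsi; exact.
move: int_close avg_close; rewrite !ler_norml.
move=> /andP[h1 h2] /andP[h3 h4] /andP[h5 h6]; apply/andP; split; lra.
Unshelve. all: by end_near. Qed.

End CompactMetric.

(** * Separation of ergodic measures by a continuous function *)

Lemma bounded_convergence {d} {T : measurableType d} {R : realType}
    (P : probability T R) (F : nat -> T -> R) (G : T -> R) (B : R) :
  (forall n, bounded_measurable (F n)) -> bounded_measurable G ->
  (forall n x, `|F n x| <= B) ->
  {ae P, forall x, F n x @[n --> \oo] --> G x} ->
  \int[P]_x F n x @[n --> \oo] --> \int[P]_x G x.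
Proof.
move=> bF bG FB FG.
have [| | |||_ _ h] := @dominated_convergence _ T R P setT measurableT
  (fun n x => (F n x)%:E) (fun x => (G x)%:E) (cst B%:E).
- by move=> n; apply/measurable_EFinP; case: (bF n).
- by apply/measurable_EFinP; case: bG.
- by apply: filterS FG => x Fx _; apply/fine_cvgP; split => //; exact: nearW.
- exact: (bounded_measurable_integrable P (bounded_measurable_cst B)).
- by apply: aeW => x n _; rewrite lee_fin.
have fin : (\int[P]_x (G x)%:E)%E \is a fin_num.
  exact: integrable_fin_num (bounded_measurable_integrable P bG).
by apply: fine_cvg; rewrite fineK.
Qed.

Section Separation.
Context {R : realType} {X : pmetricType R}.
Implicit Types (f : X -> X) (phi : X -> R) (x y : X).

Definition dist_to (C : set X) x : R := inf [set mdist c x | c in C].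

Lemma dist_to_le (C : set X) c x : C c -> dist_to C x <= mdist c x.
Proof.
move=> Cc; apply: ge_inf; last by exists c.
by exists 0 => _ [c' _ <-]; exact: mdist_ge0.
Qed.

Lemma le_dist_to (C : set X) r x : C !=set0 ->
  (forall c, C c -> r <= mdist c x) -> r <= dist_to C x.
Proof.
move=> [c0 C0] h; apply: lb_le_inf; first by exists (mdist c0 x), c0.
by move=> _ [c Cc <-]; exact: h.
Qed.

Lemma continuous_dist_to (C : set X) : C !=set0 -> continuous (dist_to C).
Proof.
move=> C0.
have lip x y : dist_to C x - mdist y x <= dist_to C y.
  apply: le_dist_to => // c Cc; rewrite lerBlDr.
  exact: le_trans (dist_to_le x Cc) (metric_triangle c y x).
move=> x; apply/cvgrPdist_lt => e e0; near=> y.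
have yx : mdist x y < e by near: y; exact: nbhs_mdist.
have := lip x y; have := lip y x; rewrite (metric_sym y x) ltr_norml => h1 h2.
apply/andP; split; lra.
Unshelve. all: by end_near. Qed.

Lemma closed_dist_to_gt0 (C : set X) x : closed C -> C !=set0 -> ~ C x ->
  0 < dist_to C x.
Proof.
move=> cC C0 Cx; have : open (~` C) by exact: closed_openC.
rewrite openE => /(_ x Cx) /nbhs_ballP[e /= e0 eC].
apply: lt_le_trans e0 _; apply: le_dist_to => // c Cc.
rewrite leNgt; apply/negP => cx; have : ball x e c by rewrite ballEmdist/= metric_sym.
by move/eC.
Qed.

Lemma continuous_min_cst phi (r : R) : continuous phi ->
  continuous (fun x => Num.min r (phi x)).
Proof.
by move=> cphi x; apply: continuous_min; [exact: cst_continuous|exact: cphi].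
Qed.

(** Open sets form a generating family closed under intersection, and the indicator of a proper open
    set is the limit of the truncated multiples [F n] of the distance to its complement. *)
Lemma probability_eq_of_continuous (mu nu : probability (borel X) R) :
  compact [set: X] ->
  (forall phi, continuous phi -> \int[mu]_x phi x = \int[nu]_x phi x) ->
  forall A : set (borel X), measurable A -> mu A = nu A.
Proof.
move=> cX mn A mA.
refine (@measure_unique _ R (borel X) (@open X) (fun=> setT) erefl _ _ _ mu nu _ _ A mA).
- exact: openI.
- by move=> ?; exact: openT.
- by rewrite bigcup_const.
- move=> O oO; have mO : measurable (O : set (borel X)) by exact: sub_sigma_algebra.
  (* The whole space is treated apart, since the distance to an empty complement is a default
     value. *)
  have [OT|C0] := pselect (O = setT); first by rewrite OT; exact: etrans (probability_setT mu) (esym (probability_setT nu)).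
  have {}C0 : ~` O !=set0.
    by apply/set0P/eqP => /(congr1 setC); rewrite setCK setC0.
  pose F (n : nat) (x : X) := Num.min 1 (n%:R * dist_to (~` O) x).
  have cF n : continuous (F n).
    apply: continuous_min_cst => x.
    by apply: cvgM; [exact: cvg_cst|exact: continuous_dist_to].
  have D0 x : 0 <= dist_to (~` O) x.
    by apply: le_dist_to => // c _; exact: mdist_ge0.
  have FG (m : probability (borel X) R) :
      \int[m]_x F n x @[n --> \oo] --> \int[m]_x (\1_O : borel X -> R) x.
    apply: (@bounded_convergence _ _ _ _ _ _ 1).
    - by move=> n; exact: bounded_measurable_continuous.
    - exact: bounded_measurable_indic.
    - move=> n x; rewrite ger0_norm ?ge_min ?lexx// le_min ler01/=.
      by rewrite mulr_ge0.
    - apply: aeW => x; rewrite indicE.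
      have [xO|xO] := boolP (x \in O); last first.
        have -> : F ^~ x = cst 0; last exact: cvg_cst.
        apply/funext => n; rewrite /F (_ : dist_to _ x = 0); first by rewrite mulr0 min_r.
        apply/eqP; rewrite eq_le D0 andbT -(mdistxx x); apply: dist_to_le.
        by rewrite notin_setE in xO.
      have dx : 0 < dist_to (~` O) x.
        apply: closed_dist_to_gt0 => //; first exact: open_closedC.
        by rewrite inE in xO => /(_ xO).
      apply: cvg_near_cst; exists (Num.trunc (dist_to (~` O) x)^-1).+1 => // n /= nN.
      rewrite /F min_l// -ler_pdivrMr// mul1r.
      by rewrite (le_trans (ltW (truncnS_gt _)))// ler_nat.
  have eqI : \int[mu]_x (\1_O : borel X -> R) x = \int[nu]_x (\1_O : borel X -> R) x.
    have := FG mu; have -> : (fun n => \int[mu]_x F n x) = (fun n => \int[nu]_x F n x).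
      by apply/funext => n; exact: mn.
    by move=> h; apply: cvg_unique h (FG nu).
  move: eqI; rewrite /Rintegral !integral_indic// !setIT => eqI.
  have muO := fineK (fin_num_measure mu _ mO); have nuO := fineK (fin_num_measure nu _ mO).
  exact: etrans (esym muO) (etrans (congr1 EFin eqI) nuO).
- by move=> ?; rewrite (le_lt_trans (probability_le1 _ _))// ltry.
Qed.

(** Some continuous [phi] has distinct integrals [a] and [b]. Its Birkhoff averages tend to [a]
    almost everywhere for [mu] and to [b] for [nu], so composing them with a tent function equal to
    1 at [a] and 0 at [b] gives integrals tending to 1 and to 0. *)
Lemma ergodic_separation f (mu nu : probability (borel X) R) (delta : R) :
  compact [set: X] -> continuous f -> ergodic_measure f mu -> ergodic_measure f nu ->
  (exists2 A : set (borel X), measurable A & mu A <> nu A) -> 0 < delta ->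
  exists psi : X -> R, [/\ continuous psi, forall x, 0 <= psi x <= 1,
    2^-1 < \int[mu]_x psi x & \int[nu]_x psi x < delta].
Proof.
move=> cX cf emu enu [A mA mnA] delta0.
have [phi cphi mnphi] : exists2 phi : X -> R, continuous phi &
    \int[mu]_x phi x <> \int[nu]_x phi x.
  apply: contrapT => h; apply: mnA; apply: probability_eq_of_continuous => // phi cphi.
  by apply: contrapT => h'; apply: h; exists phi.
set a := \int[mu]_x phi x in mnphi; set b := \int[nu]_x phi x in mnphi.
have ab0 : 0 < `|a - b| by rewrite normr_gt0 subr_eq0; exact/eqP.
pose h (t : R) := Num.max 0 (1 - `|t - a| / `|a - b|).
have ch : continuous h.
  move=> t; apply: (@continuous_max _ _ (cst 0) (fun t => 1 - `|t - a| / `|a - b|)).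
    exact: cst_continuous.
  apply: cvgB; first exact: cvg_cst.
  apply: cvgM; last exact: cvg_cst.
  by apply: cvg_norm; apply: cvgB; [exact: cvg_id|exact: cvg_cst].
have h01 t : 0 <= h t <= 1.
  rewrite /h le_max lexx/= ge_max ler01/= gerBl.
  by rewrite divr_ge0.
have ha : h a = 1 by rewrite /h subrr normr0 mul0r subr0 max_r.
have hb : h b = 0.
  by rewrite /h distrC divff ?gt_eqF// subrr max_l.
pose psi n x := h (orbit_sum f phi n x / n%:R).
have cpsi n : continuous (psi n).
  move=> x; apply: (@continuous_comp _ _ _ (fun x => orbit_sum f phi n x / n%:R) h).
    by apply: cvgM; [exact: continuous_orbit_sum|exact: cvg_cst].
  exact: ch.
have psi_cvg (m : probability (borel X) R) : ergodic_measure f m ->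
    \int[m]_x psi n x @[n --> \oo] --> h (\int[m]_x phi x).
  move=> em; have -> : h (\int[m]_x phi x) = \int[m]_x (cst (h (\int[m]_x phi x)) : borel X -> R) x.
    by rewrite Rintegral_cst// [X in fine X](probability_setT m) mulr1.
  apply: (@bounded_convergence _ _ _ _ _ _ 1).
  - by move=> n; exact: bounded_measurable_continuous.
  - exact: bounded_measurable_cst.
  - by move=> n x; have /andP[? ?] := h01 (orbit_sum f phi n x / n%:R); rewrite ger0_norm.
  have := birkhoff_ergodic (measurable_borel_continuous cf) em
    (bounded_measurable_continuous cX cphi).
  by apply: filterS => x; apply: continuous_cvg; exact: ch.
have := psi_cvg _ emu; have := psi_cvg _ enu; rewrite -/a -/b ha hb => hnu hmu.
have [n [n1 n2]] : exists n, 2^-1 < \int[mu]_x psi n x /\ \int[nu]_x psi n x < delta.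
  apply: (@filter_ex _ \oo); apply: filterI.
    by apply: (cvgr_gt _ hmu); rewrite invf_lt1// ltr1n.
  exact: (cvgr_lt _ hnu).
by exists (psi n); split=> // x; exact: h01.
Qed.

End Separation.

(** * Specification with linear gaps *)

Section Specification.
Context {R : realType} {X : pmetricType R}.
Implicit Types (e : R) (f : X -> X) (M : nat -> R -> nat) (psi : X -> R) (x y : X).

Definition linear_gaps M (D : nat) := forall e : R, 0 < e -> forall N : nat,
  exists n, [/\ (N <= n)%N, (0 < n)%N & (M n e <= D * n)%N].

(** If at some scale all large [n] had a gap above [D * n], the lower limit there would be at least
    [D], which exceeds [tau]. Hence one [D] serves every scale. *)
Lemma gap_tau_linear_gaps M (tau : R) : gap_tau M = tau%:E ->
  exists D, linear_gaps M D.
Proof.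
move=> Mtau; exists (Num.trunc tau).+1 => e e0 N; set D := (Num.trunc tau).+1.
apply: contrapT => H.
have tauD : tau < D%:R by exact: truncnS_gt.
have : (D%:R%:E <= tau%:E :> \bar R)%E; last by rewrite lee_fin leNgt tauD.
rewrite -Mtau; apply: le_trans (ereal_sup_ubound _); last by exists e.
rewrite limn_einf_lim; apply: lime_ge; first exact: is_cvg_einfs.
exists (maxn N 1) => // k /= Nk; apply: le_ereal_inf_tmp => _ /= [n /= kn <-].
have n0 : (0 < n)%N by lia.
rewrite lee_fin ler_pdivlMr ?ltr0n// -natrM ler_nat leqNgt; apply/negP => h.
by apply: H; exists n; split=> //; lia.
Qed.

(** The second block starts at the earliest time that the gap after the first one permits. *)
Lemma specification_two f M e n n' x y : nonuniform_specification f M ->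
  0 < e -> (0 < n)%N ->
  exists w, (forall j, (j < n)%N -> mdist (iter j f x) (iter j f w) <= e) /\
    (forall j, (j < n')%N ->
       mdist (iter j f y) (iter (n.-1 + M n e + j) f w) <= e).
Proof.
move=> [[M0 _ _] spec] e0 n0.
pose xs (i : 'I_2) := if val i is 0%N then x else y.
pose s := (n.-1 + M n e)%N.
pose a (i : 'I_2) := if val i is 0%N then 0%N else s.
(* For [n' = 0] the truncated predecessor leaves a block of one point, about which nothing is
   claimed. *)
pose b (i : 'I_2) := if val i is 0%N then n.-1 else (s + n'.-1)%N.
have [//|//|i|i j|z zP] := spec e 2%N xs a b.
- by rewrite /a /b; case: (val i) => //; lia.
- have := ltn_ord j; rewrite /a /b /= => + ji.
  rewrite ji; case: (nat_of_ord i) => // _; rewrite subn0 prednK//.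
  by have := M0 n e n0 e0; rewrite /s; lia.
exists z; split=> j jn.
  by have := zP ord0 j; rewrite /a /b/= subn0; apply; lia.
have := zP ord_max (s + j)%N; rewrite /a /b/= addKn; apply; lia.
Qed.

(** Finitely many copies of the block are shadowed at equally spaced times, and a cluster point
    handles infinitely many. Only the shadowed pattern is periodic; [p] itself need not be. *)
Lemma specification_periodic f M e n x : compact [set: X] -> continuous f ->
  nonuniform_specification f M -> 0 < e -> (0 < n)%N ->
  exists p, forall i j, (j < n)%N ->
    mdist (iter j f x) (iter (i * (n.-1 + M n e) + j) f p) <= e.
Proof.
move=> cX cf [[M0 _ _] spec] e0 n0; set P := (n.-1 + M n e)%N.
have fin k : exists z, forall i j, (i < k)%N -> (j < n)%N ->
    mdist (iter j f x) (iter (i * P + j) f z) <= e.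
  (* Two spare copies meet the requirement of at least two blocks. *)
  have [//|//|i|i j|z zP] := spec e k.+2 (fun=> x) (fun i => (i * P)%N)
    (fun i => (i * P + n.-1)%N).
  - by lia.
  - move=> ->; rewrite addKn prednK// mulSn.
    by have := M0 n e n0 e0; rewrite /P; lia.
  exists z => i j ik jn.
  have := zP (Ordinal (leqW (leqW ik))) (i * P + j)%N; rewrite /= addKn; apply; lia.
have [z zP] := choice fin.
have [p pP] := compact_cluster z cX.
exists p => i j jn.
apply: (pP [set w | mdist (iter j f x) (iter (i * P + j) f w) <= e]).
  by apply: closed_mdist_le; exact: continuous_iter.
by exists i.+1 => // k /= ik; exact: zP.
Qed.

Lemma orbit_sum_nonneg f psi n x : (forall x, 0 <= psi x) -> 0 <= orbit_sum f psi n x.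
Proof. by move=> psi0; apply: sumr_ge0. Qed.

Lemma orbit_sum_shadow f psi (d : R) n x y :
  (forall j, (j < n)%N -> psi (iter j f x) <= psi (iter j f y) + d) ->
  orbit_sum f psi n x - d * n%:R <= orbit_sum f psi n y.
Proof.
move=> h; rewrite lerBlDr mulr_natr -[n in _ *+ n]card_ord -sumr_const -big_split/=.
by apply: ler_sum => i _; exact: h.
Qed.

Lemma iterDE f m n x : iter m f (iter n f x) = iter (n + m) f x.
Proof. by rewrite addnC iterD. Qed.

(** The repeated block starts near [x] and then follows [g] for [n] steps. These contribute at least
    [n / 4] per period: a mean of 1/2 less a shadowing loss of 1/4. As [P] is at most
    [2 * D.+1 * n], this yields the rate 1/(8(D+1)). *)
Lemma periodic_tracking f M D psi g (e r : R) N : compact [set: X] -> continuous f ->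
  nonuniform_specification f M -> linear_gaps M D ->
  (forall x, 0 <= psi x) ->
  (forall x y, mdist x y <= 2 * e -> psi x <= psi y + 4^-1) ->
  (forall n, (N <= n)%N -> n%:R / 2 <= orbit_sum f psi n g) -> 0 < e ->
  exists P : nat, (0 < P)%N /\ forall x, exists p,
    (forall i, mdist x (iter (i * P) f p) <= 2 * e) /\
    forall m, (8 * D.+1%:R)^-1 * (m%:R - P%:R) <= orbit_sum f psi m p.
Proof.
move=> cX cf spec gaps psi0 psie gN e0.
have [[M0 _ _] _] := spec.
(* This lower bound on [n'] gives both [N <= n] and [n' <= 2 * n]. *)
have [n' [n'N n'0 n'D]] := gaps e e0 (2 * (M 1 e + N) + 1)%N.
pose n := (n' - M 1 e)%N; pose P := (n'.-1 + M n' e)%N.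
have M'0 := M0 n' e n'0 e0.
have P0 : (0 < P)%N by rewrite /P; lia.
exists P; split=> // x.
have [w [wx wg]] := @specification_two f M e 1 n x g spec e0 isT.
have [p pw] := specification_periodic w cX cf spec e0 n'0.
have near_x i : mdist x (iter (i * P) f p) <= 2 * e.
  have h1 := wx 0%N isT; have := pw i 0%N n'0; rewrite addn0/= => h2.
  have := metric_triangle x w (iter (i * P) f p).
  by move: h1; rewrite /= /P; lra.
exists p; split=> //.
have block i : n%:R / 4 <= orbit_sum f psi P (iter (i * P) f p).
  have splitP : P = (M 1 e + (n + (P - M 1 e - n)))%N by rewrite /P /n; lia.
  rewrite [X in orbit_sum _ _ X]splitP !orbit_sumD.
  have h : orbit_sum f psi n g - 4^-1 * n%:R <=
      orbit_sum f psi n (iter (M 1 e) f (iter (i * P) f p)).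
    apply: orbit_sum_shadow => j jn; apply: psie; rewrite !iterDE.
    have := wg j jn; rewrite add0n => h1.
    have h2 := pw i (M 1 e + j)%N ltac:(rewrite /n in jn; lia).
    have := metric_triangle (iter j f g) (iter (M 1 e + j) f w)
      (iter (i * P + (M 1 e + j)) f p).
    by rewrite addnA in h2 *; rewrite /P; lra.
  have hg := gN n ltac:(rewrite /n; lia).
  have := orbit_sum_nonneg f (M 1 e) (iter (i * P) f p) psi0.
  have := orbit_sum_nonneg f (P - M 1 e - n) (iter n f (iter (M 1 e) f (iter (i * P) f p))) psi0.
  lra.
set c := (8 * D.+1%:R)^-1.
have c0 : 0 < c by rewrite invr_gt0 mulr_gt0.
have cP : c * P%:R <= n%:R / 4.
  rewrite /c mulrC ler_pdivrMr ?mulr_gt0// mulrA.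
  have -> : n%:R / 4 * 8 = n%:R * 2 :> R by lra.
  by rewrite -!natrM ler_nat /P /n; nia.
have mult i : c * (i * P)%:R <= orbit_sum f psi (i * P) p.
  elim: i => [|i IH]; first by rewrite mul0n mulr0 orbit_sum_nonneg.
  rewrite mulSnr orbit_sumD natrD mulrDr.
  apply: lerD => //; exact: le_trans cP (block i).
(* The incomplete last period is dropped, at the cost of the term in [P]. *)
move=> m; rewrite [in leRHS](divn_eq m P) orbit_sumD.
apply: (@le_trans _ _ (c * ((m %/ P) * P)%:R)).
  rewrite ler_pM2l// lerBlDr -natrD ler_nat.
  by have := ltn_pmod m P0; have := divn_eq m P; lia.
by apply: ler_wpDr; [exact: orbit_sum_nonneg|exact: mult].
Qed.

Lemma uniform_iter f P (d : R) : compact [set: X] -> continuous f -> 0 < d ->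
  exists2 r, 0 < r & forall x y j, (j <= P)%N -> mdist x y < r ->
    mdist (iter j f x) (iter j f y) < d.
Proof.
move=> cX cf d0; elim: P => [|P [r r0 IH]].
  by exists d => // x y j; rewrite leqn0 => /eqP ->.
have [r' r'0 h] := compact_uniform_continuous cX (@continuous_iter _ _ f P.+1 cf) d0.
exists (Num.min r r'); first by rewrite lt_min r0.
move=> x y j; rewrite leq_eqVlt lt_min => /predU1P[-> | jP] /andP[xr xr'].
  by have := h x y xr'; rewrite ballEmdist.
exact: IH.
Qed.

(** At all multiples of [P] one orbit is near [x] and the other near [y]. If they were closer than
    [r] at some time, uniform continuity of the iterates up to [P] would keep them too close at the
    next multiple. *)
Lemma distal_tracking_pair f M D psi g (d : R) N : dynamical_system f ->
  nonuniform_specification f M -> linear_gaps M D ->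
  (forall x, 0 <= psi x) -> 0 < d ->
  (forall x y, mdist x y < d -> psi x <= psi y + 4^-1) ->
  (forall n, (N <= n)%N -> n%:R / 2 <= orbit_sum f psi n g) ->
  exists p q (C t : R), [/\ 0 < t, forall n, t <= mdist (iter n f p) (iter n f q),
    forall m, (8 * D.+1%:R)^-1 * m%:R - C <= orbit_sum f psi m p &
    forall m, (8 * D.+1%:R)^-1 * m%:R - C <= orbit_sum f psi m q].
Proof.
move=> [cX [x [y xy]] cf] spec gaps psi0 d0 psid gN.
have xy0 : 0 < mdist x y by rewrite mdist_gt0; exact/eqP.
(* The errors [2 * e] at [x] and at [y] then use up at most half of [mdist x y], and [2 * e < d]. *)
pose e := Num.min d (mdist x y) / 8.
have m0 : 0 < Num.min d (mdist x y) by rewrite lt_min d0.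
have e0 : 0 < e by rewrite divr_gt0.
have ed : e <= d / 8 by rewrite ler_pM2r ?invr_gt0// ge_min lexx.
have exy : e <= mdist x y / 8 by rewrite ler_pM2r ?invr_gt0// ge_min lexx orbT.
have psie u v : mdist u v <= 2 * e -> psi u <= psi v + 4^-1.
  by move=> uv; apply: psid; lra.
have [P [P0 HP]] := periodic_tracking 0 cX cf spec gaps psi0 psie gN e0.
have [p [px pS]] := HP x; have [q [qy qS]] := HP y.
have [r r0 rP] := uniform_iter P cX cf (divr_gt0 xy0 (ltr0n R 2)).
exists p, q, ((8 * D.+1%:R)^-1 * P%:R), r; split=> //; last 2 first.
- by move=> m; rewrite -mulrBr.
- by move=> m; rewrite -mulrBr.
move=> n; rewrite leNgt; apply/negP => pq.
have := rP _ _ (((n %/ P).+1 * P) - n)%N _ pq.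
rewrite !iterDE (subnKC _); last by have := divn_eq n P; have := ltn_pmod n P0; lia.
have h : ((n %/ P).+1 * P - n <= P)%N by have := divn_eq n P; lia.
move=> /(_ h).
have := px (n %/ P).+1; have := qy (n %/ P).+1.
move: (iter _ f p) (iter _ f q) => u v yv xu uv.
have := metric_triangle x u y; have := metric_triangle u v y.
rewrite (metric_sym v y); lra.
Qed.

End Specification.

(** * Shadowing along a rapidly growing schedule *)

Section Shadowing.
Context {R : realType} {X : pmetricType R}.
Implicit Types (e : R) (f : X -> X) (M : nat -> R -> nat) (psi : X -> R) (x y : X).

(* Stage k visits a target at time s k and follows an orbit during [a k, L k.+1). *)
Definition schedule (D : nat) (L s a : nat -> nat) :=
  forall k, [/\ (0 < L k)%N, (L k <= s k)%N, (s k < a k)%N,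
    (a k <= D.+2 * L k)%N & (k.+2 * a k <= L k.+1)%N].

Definition follows f (L s a : nat -> nat) e (target tracked : nat -> X) z :=
  forall k, mdist (target k) (iter (s k) f z) <= e / 2 ^+ k /\
    forall j, (j < L k.+1 - a k)%N ->
      mdist (iter j f (tracked k)) (iter (a k + j) f z) <= e / 2 ^+ k.

Lemma schedule_ltS D L s a : schedule D L s a -> forall k, (a k < L k.+1)%N.
Proof. by move=> sch k; have [? ? ? ? ?] := sch k; nia. Qed.

Lemma schedule_leS D L s a : schedule D L s a -> forall k, (L k < L k.+1)%N.
Proof. by move=> sch k; have := schedule_ltS sch k; have [? ? ? ? ?] := sch k; lia. Qed.

Lemma schedule_le D L s a : schedule D L s a ->
  {homo L : m n / (m <= n)%N}.
Proof.
move=> sch; apply: homo_leq => [//|? ? ?|k]; first exact: leq_trans.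
exact/ltnW/(schedule_leS sch).
Qed.

Lemma schedule_ge D L s a : schedule D L s a -> forall k, (k < L k)%N.
Proof.
move=> sch; elim=> [|k IH]; first by have [] := sch 0%N.
by have := schedule_leS sch k; lia.
Qed.

(** The times depend only on the gap function, so one schedule serves all choices of targets and
    tracked orbits. Successive points are glued to the orbit built so far with geometrically
    decreasing errors, and a cluster point inherits every stage. *)
Lemma specification_schedule f M D e u : compact [set: X] -> continuous f ->
  nonuniform_specification f M -> linear_gaps M D -> 0 < e ->
  exists L s a, schedule D L s a /\ forall target tracked, exists z,
    mdist u z <= e /\ follows f L s a e target tracked z.
Proof.
move=> cX cf spec gaps e0.
have [[M0 _ _] _] := spec.
(* Stage [k] makes two errors [E k], and all later stages together add at most [e / 2 ^+ k.+2],
   which stays below [e / 2 ^+ k]. *)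
pose E k := e / 2 ^+ k.+2.
have E0 k : 0 < E k by rewrite divr_gt0// exprn_gt0.
have Gex (kN : nat * nat) : exists n, [/\ (kN.2 <= n)%N, (0 < n)%N &
    (M n (E kN.1) <= D * n)%N] by exact: gaps.
have [G GP] := choice Gex.
pose start k n := (n.-1 + M n (E k))%N.
(* The first bound under [maxn] makes each stage dominate the past. The second gives
   [M 1 (E k) <= L k], whence [a k <= D.+2 * L k]. *)
pose L := fix L k := if k is k'.+1
  then G (k, maxn (k.+1 * (start k' (L k') + M 1 (E k'))) (M 1 (E k)))
  else G (0, M 1 (E 0))%N.
pose s k := start k (L k); pose a k := (s k + M 1 (E k))%N.
have LG k : exists N, L k = G (k, N) /\ (M 1 (E k) <= N)%N.
  case: k => [|k]; first by exists (M 1 (E 0%N)).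
  by exists (maxn (k.+2 * (start k (L k) + M 1 (E k))) (M 1 (E k.+1))); split=> //; exact: leq_maxr.
have sch : schedule D L s a.
  move=> k; have [N [LGk MN]] := LG k; have [] := GP (k, N); rewrite -LGk/= => h1 h2 h3.
  have h4 := M0 (L k) (E k) h2 (E0 k); have h5 := M0 1%N (E k) isT (E0 k).
  split => //; rewrite /a /s /start; [lia|lia|nia|].
  have [h6 _ _] := GP (k.+1, maxn (k.+2 * (start k (L k) + M 1 (E k))) (M 1 (E k.+1))).
  by apply: leq_trans h6; exact: leq_maxl.
have sE k : s k = ((L k).-1 + M (L k) (E k))%N by [].
have aE k : a k = (s k + M 1 (E k))%N by [].
clear LG; clearbody a; clearbody s; clearbody L.
exists L, s, a; split=> // target tracked.
(* Two gluings: [w] visits the target at time 0 and then follows the tracked orbit; [v] follows the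
   old point up to [L k] and then [w] from time [s k]. *)
have nextex (kx : nat * X) : exists v,
    [/\ forall j, (j < L kx.1)%N -> mdist (iter j f kx.2) (iter j f v) <= E kx.1,
      mdist (target kx.1) (iter (s kx.1) f v) <= E kx.1 + E kx.1 &
      forall j, (j < L kx.1.+1 - a kx.1)%N ->
        mdist (iter j f (tracked kx.1)) (iter (a kx.1 + j) f v) <= E kx.1 + E kx.1].
  case: kx => k x /=.
  have [w [w1 w2]] := specification_two (L k.+1 - a k) (target k) (tracked k) spec (E0 k)
    (isT : (0 < 1)%N).
  have [L0 _ _ _ _] := sch k.
  have [v [v1 v2]] := specification_two (L k.+1) x w spec (E0 k) L0.
  exists v; split=> //.
    have h1 := w1 0%N isT; have h2 := v2 0%N ltac:(by case: (sch k.+1)).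
    have := metric_triangle (target k) w (iter (s k) f v).
    by move: h1 h2; rewrite addn0 /= -sE; lra.
  move=> j ja; have h1 := w2 j ja.
  have jL : (M 1 (E k) + j < L k.+1)%N.
    by move: ja; rewrite aE; lia.
  have h2 := v2 _ jL.
  have := metric_triangle (iter j f (tracked k)) (iter (M 1 (E k) + j) f w)
    (iter (a k + j) f v).
  by move: h1 h2; rewrite /= add0n addnA -sE -aE; lra.
have [next nextP] := choice nextex.
pose z := fix z k := if k is k'.+1 then next (k', z k') else u.
have e2S k : e / 2 ^+ k.+1 + e / 2 ^+ k.+1 = e / 2 ^+ k by rewrite exprS invfM; lra.
have EE k : E k + E k = e / 2 ^+ k.+1 by exact: e2S.
have e20 k : 0 < e / 2 ^+ k by rewrite divr_gt0// exprn_gt0.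
(* The errors [E k], [E k.+1], and so on telescope. *)
have zz k i j : (j < L k)%N ->
    mdist (iter j f (z k)) (iter j f (z (i + k)%N)) <= e / 2 ^+ k.+1 - e / 2 ^+ (i + k).+1.
  move=> jL; elim: i => [|i IH]; first by rewrite add0n mdistxx subrr.
  have [h _ _] := nextP ((i + k)%N, z (i + k)%N).
  have /= {}h := h j (leq_trans jL (schedule_le sch (leq_addl i k))).
  have := metric_triangle (iter j f (z k)) (iter j f (z (i + k)%N)) (iter j f (z (i.+1 + k)%N)).
  have := EE (i + k)%N; have := e2S (i + k).+1; rewrite addSn /=; lra.
have [w wP] := compact_cluster z cX.
have zw k j : (j < L k)%N -> mdist (iter j f (z k)) (iter j f w) <= e / 2 ^+ k.+1.
  move=> jL; apply: (wP [set w | mdist (iter j f (z k)) (iter j f w) <= e / 2 ^+ k.+1]).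
    by apply: closed_mdist_le; exact: continuous_iter.
  exists k => // i /= ki; have := zz k (i - k)%N j jL; rewrite subnK//.
  by have := e20 i.+1; lra.
exists w; split.
  have [L0 _ _ _ _] := sch 0%N; have := zw 0%N 0%N L0; have := e2S 0%N; have := e20 1%N.
  by rewrite expr0 divr1 /=; lra.
move=> k; have [_ h1 h2] := nextP (k, z k).
have e1 := EE k; have e2 := e2S k; have e3 := e2S k.+1; have e4 := e20 k.+2.
have aL := schedule_ltS sch k; have [_ _ sa _ _] := sch k.
split=> [|j jL].
  have := zw k.+1 (s k) ltac:(lia).
  have := metric_triangle (target k) (iter (s k) f (z k.+1)) (iter (s k) f w).
  by move: h1 => /=; lra.
have := zw k.+1 (a k + j)%N ltac:(lia); have := h2 j jL.
have := metric_triangle (iter j f (tracked k)) (iter (a k + j) f (z k.+1)) (iter (a k + j) f w).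
by move=> /=; lra.
Qed.

(** Shadowing lowers the rate from [2 * c] to [c] on tracked stretches. As these fill at least half
    of the elapsed time at [L k], the rate there is [c / 2]. Before [a k] the sum does not decrease
    while time grows by a factor of at most [D.+2], which gives the final rate. *)
Lemma follows_orbit_sum_ge f D L s a e target tracked psi (c C : R) z :
  schedule D L s a -> follows f L s a e target tracked z -> 0 < e ->
  (forall x, 0 <= psi x) -> 0 < c -> 0 <= C ->
  (forall x y, mdist x y <= e -> psi x <= psi y + c) ->
  (forall k m, 2 * c * m%:R - C <= orbit_sum f psi m (tracked k)) ->
  exists C', forall m, c / (2 * D.+2%:R) * m%:R - C' <= orbit_sum f psi m z.
Proof.
move=> sch fol e0 psi0 c0 C0 psie trackedS.
pose c' := c / (2 * D.+2%:R).
have D0 : 0 < 2 * D.+2%:R :> R by rewrite mulr_gt0.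
have c'0 : 0 < c' by rewrite divr_gt0.
have c'c : c' * (2 * D.+2%:R) = c by rewrite /c' divfK// gt_eqF.
have c'le : c' <= c / 2.
  rewrite -c'c; have : c' * 1 <= c' * D.+2%:R by rewrite ler_pM2l// ler1n.
  lra.
have block k r : (r <= L k.+1 - a k)%N -> c * r%:R - C <= orbit_sum f psi r (iter (a k) f z).
  move=> rL; have h := trackedS k r.
  have h2 : orbit_sum f psi r (tracked k) - c * r%:R <= orbit_sum f psi r (iter (a k) f z).
    apply: orbit_sum_shadow => j jr; rewrite iterDE; apply: psie.
    have [_ h3] := fol k; apply: le_trans (h3 j (leq_trans jr rL)) _.
    by rewrite ler_pdivrMr ?exprn_gt0// -[leLHS]mulr1 ler_pM2l// exprn_ege1// ler1n.
  lra.
(* [C1] makes the bound trivial at [L 0] and [L 1], so only later stages need an estimate. *)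
pose C1 := C + c * (L 1%N)%:R.
have at_L k : c / 2 * (L k)%:R - C1 <= orbit_sum f psi (L k) z.
  have cL : 0 <= c * (L 1%N)%:R by rewrite mulr_ge0// ltW.
  have [k1|k1] := leqP k 1.
    have : c * (L k)%:R <= c * (L 1%N)%:R.
      by rewrite ler_pM2l// ler_nat; exact: schedule_le sch _ _ k1.
    have := orbit_sum_nonneg f (L k) z psi0.
    have : 0 <= c * (L k)%:R by rewrite mulr_ge0// ltW.
    rewrite /C1; lra.
  case: k k1 => // k k0; have aL := schedule_ltS sch k; have [_ _ _ _ h] := sch k.
  rewrite [X in orbit_sum _ _ X](_ : L k.+1 = a k + (L k.+1 - a k))%N; last by lia.
  rewrite orbit_sumD; have := block k _ (leqnn _).
  have := orbit_sum_nonneg f (a k) z psi0.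
  have : 2 * (c * (a k)%:R) <= c * (L k.+1)%:R.
    by rewrite mulrCA ler_pM2l// -natrM ler_nat; nia.
  rewrite (natrB _ (ltnW aL)) mulrBr /C1; lra.
exists (C1 + C + c' * (L 0%N)%:R).
have cL0 : 0 <= c' * (L 0%N)%:R by rewrite mulr_ge0// ltW.
have cL1 : 0 <= c * (L 1%N)%:R by rewrite mulr_ge0// ltW.
have upto k m : (m <= L k)%N -> c' * m%:R - (C1 + C + c' * (L 0%N)%:R) <= orbit_sum f psi m z.
  elim: k m => [|k IH] m mL.
    have := orbit_sum_nonneg f m z psi0.
    have : c' * m%:R <= c' * (L 0%N)%:R by rewrite ler_pM2l// ler_nat.
    rewrite /C1; lra.
  have [mk|km] := leqP m (L k); first exact: IH.
  have [L0 Ls sa aD _] := sch k.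
  have early n : (L k <= n)%N -> (n <= a k)%N -> c' * n%:R - C1 <= orbit_sum f psi n z.
    move=> Ln na; rewrite -(subnKC Ln) orbit_sumD subnKC//.
    have := orbit_sum_nonneg f (n - L k) (iter (L k) f z) psi0; have := at_L k.
    have : c' * n%:R <= c' * (D.+2 * L k)%:R.
      by rewrite ler_pM2l// ler_nat (leq_trans na).
    have -> : c' * (D.+2 * L k)%:R = c / 2 * (L k)%:R.
      by rewrite -c'c natrM; lra.
    lra.
  have [ma|am] := leqP m (a k); first by have := early m (ltnW km) ma; lra.
  have := early (a k) ltac:(lia) (leqnn _).
  have := block k (m - a k)%N ltac:(lia).
  have := subnKC (ltnW am); move: (m - a k)%N => r <-.
  rewrite orbit_sumD natrD mulrDr.
  have : c' * r%:R <= c / 2 * r%:R by rewrite ler_wpM2r.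
  have : 0 <= c * r%:R by rewrite mulr_ge0// ltW.
  lra.
by move=> m; apply: (upto m); exact/ltnW/(schedule_ge sch m).
Qed.

End Shadowing.

(** * Frequencies and empirical measures *)

Lemma limn_esup_frequently {R : realType} (v : nat -> R) (r : R) :
  (forall n, v n <= r) ->
  (forall e, 0 < e -> forall N, exists2 n, (N <= n)%N & r - e <= v n) ->
  limn_esup (fun n => (v n)%:E) = r%:E.
Proof.
move=> vr vfreq; rewrite limn_esup_lim (_ : esups _ = cst r%:E) ?lim_cst//.
apply/funext => N /=; apply/eqP; rewrite eq_le; apply/andP; split.
  by apply: ge_ereal_sup => _ [n _ <-]; rewrite lee_fin.
apply/lee_addgt0Pr => e e0; have [n Nn vn] := vfreq e e0 N.
apply: (@le_trans _ _ ((v n)%:E + e%:E)%E); first by rewrite -EFinD lee_fin; lra.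
by rewrite leeD2r//; apply: ereal_sup_ubound; exists n.
Qed.

Lemma limn_einf_frequently {R : realType} (v : nat -> R) (r : R) :
  (forall n, r <= v n) ->
  (forall e, 0 < e -> forall N, exists2 n, (N <= n)%N & v n <= r + e) ->
  limn_einf (fun n => (v n)%:E) = r%:E.
Proof.
move=> vr vfreq; rewrite /limn_einf (@limn_esup_frequently _ (fun n => - v n) (- r)).
- by rewrite EFinN oppeK.
- by move=> n; rewrite lerN2.
- move=> e e0 N; have [n Nn vn] := vfreq e e0 N; exists n => //; lra.
Qed.

Lemma card_ord_le (n a : nat) (Q : pred nat) :
  (forall j, (j < n)%N -> Q j -> (j < a)%N) -> (#|[pred j : 'I_n | Q j]| <= a)%N.
Proof.
move=> Qa; rewrite cardE -(size_map val) -[a in leqRHS](size_iota 0).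
apply: uniq_leq_size; first by rewrite (map_inj_uniq val_inj) enum_uniq.
move=> _ /mapP[j + ->]; rewrite mem_enum inE mem_iota /= => Qj.
exact: Qa.
Qed.

Lemma card_ord_ge (n a : nat) (Q : pred nat) :
  (forall j, (a <= j < n)%N -> Q j) -> (n - a <= #|[pred j : 'I_n | Q j]|)%N.
Proof.
move=> Qa; have := cardC [pred j : 'I_n | Q j]; rewrite card_ord => /esym Hn.
have : (#|[predC [pred j : 'I_n | Q j]]| <= a)%N.
  apply: (@card_ord_le n a (fun j => ~~ Q j)) => j jn; rewrite ltnNge.
  by apply: contraNN => aj; rewrite Qa// aj.
by move=> h; rewrite leq_subLR [leqLHS]Hn addnC leq_add2r.
Qed.

Section Frequency.
Context {R : realType} {X : pmetricType R}.
Implicit Types (f : X -> X) (phi psi : X -> R) (x y : X).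

(** Since [a k] is negligible against [L k.+1], the behaviour on the tracked stretch alone decides
    the frequency at time [L k.+1]. *)
Lemma DC1_pair_of_schedule f x y (L a : nat -> nat) t0 : 0 < t0 ->
  (forall k, (k < L k)%N /\ (k.+2 * a k <= L k.+1)%N) ->
  (forall t, 0 < t -> forall N, exists2 k, (N <= k)%N &
     forall j, (a k <= j < L k.+1)%N -> mdist (iter j f x) (iter j f y) < t) ->
  (forall N, exists2 k, (N <= k)%N &
     forall j, (a k <= j < L k.+1)%N -> t0 <= mdist (iter j f x) (iter j f y)) ->
  DC1_pair f x y.
Proof.
move=> t00 sch close far.
have fraction (e : R) N : 0 < e -> exists K, forall k, (K <= k)%N ->
    (N <= L k.+1)%N /\ (a k)%:R <= e * (L k.+1)%:R.
  move=> e0; exists (maxn N (Num.trunc e^-1)) => k; rewrite geq_max => /andP[Nk ek].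
  have [kL _] := sch k.+1; have [_ aL] := sch k; split; first by lia.
  have ke : e^-1 <= k.+2%:R.
    by rewrite (le_trans (ltW (truncnS_gt _)))// ler_nat ltnS leqW.
  rewrite -ler_pdivrMl// (le_trans (ler_wpM2r _ ke))// -natrM ler_nat//.
split=> [t tpos|].
  apply: limn_esup_frequently => [n|e e0 N].
    (* At [n = 0] the quotient is 0 by the convention for the inverse. *)
    have [->|n0] := posnP n; first by rewrite invr0 mulr0.
    rewrite ler_pdivrMr ?ltr0n// mul1r ler_nat.
    by rewrite -[leqRHS](card_ord n) max_card.
  have [K KP] := fraction e N e0; have [k Kk xy] := close t tpos K.
  have [NL aL] := KP k Kk; exists (L k.+1) => //.
  have L0 : (0 < L k.+1)%N by have [] := sch k.+1; lia.
  rewrite ler_pdivlMr ?ltr0n//.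
  have := @card_ord_ge (L k.+1) (a k)
    (fun j => mdist (iter j f x) (iter j f y) < t) xy.
  rewrite leq_subLR -(ler_nat R) natrD; lra.
exists t0 => //; apply: limn_einf_frequently => [n|e e0 N].
  by rewrite divr_ge0.
have [K KP] := fraction e N e0; have [k Kk xy] := far K.
have [NL aL] := KP k Kk; exists (L k.+1) => //.
have L0 : (0 < L k.+1)%N by have [] := sch k.+1; lia.
rewrite add0r ler_pdivrMr ?ltr0n//; apply: le_trans aL; rewrite ler_nat.
apply: (@card_ord_le _ _ (fun j => mdist (iter j f x) (iter j f y) < t0)) => j jL.
rewrite ltnNge [in X in X -> _]ltNge; apply: contraNN => aj.
by apply: xy; rewrite aj.
Qed.

(** Adding the bound [B] makes the integrand nonnegative, so that integrals against scalings and
    sums of measures can be computed termwise; [B] is subtracted at the end. *)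
Lemma Rintegral_empirical f x n phi : compact [set: X] -> continuous phi ->
  \int[empirical f x n]_y phi y = orbit_sum f phi n.+1 x / n.+1%:R.
Proof.
move=> cX cphi; have bphi := bounded_measurable_continuous cX cphi.
have [B phiB] := compact_continuous_bounded cX cphi.
pose psi (y : borel X) := phi y + B.
have psi0 y : 0 <= psi y by have := phiB y; rewrite ler_norml /psi => /andP[? _]; lra.
have bB : bounded_measurable (cst B : borel X -> R) := bounded_measurable_cst B.
have bpsi : bounded_measurable psi by exact: bounded_measurableD.
have mpsi : measurable_fun setT (EFin \o psi) by apply/measurable_EFinP; case: bpsi.
have -> : \int[empirical f x n]_y phi y = \int[empirical f x n]_y psi y - B.
  rewrite RintegralD//; [|exact: bounded_measurable_integrable..].
  by rewrite Rintegral_cst// [X in fine X](probability_setT (empirical f x n)) mulr1 addrK.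
rewrite /Rintegral /empirical ge0_integral_mscale//; last by move=> y _; rewrite lee_fin.
rewrite ge0_integral_measure_sum//; last by move=> y _; rewrite lee_fin.
under eq_bigr do rewrite integral_dirac// diracT mul1e.
rewrite sumEFin -EFinM/= /orbit_sum /psi big_split/= sumr_const card_ord.
by rewrite mulrDr -[B *+ _]mulr_natl mulKf ?pnatr_eq0// addrK mulrC.
Qed.

Lemma weak_star_cvg (u : nat -> probability (borel X) R) (mu : probability (borel X) R) :
  (forall phi, continuous phi -> \int[u i]_x phi x @[i --> \oo] --> \int[mu]_x phi x) ->
  (fun i => u i : weak_star) @ \oo --> (mu : weak_star).
Proof.
move=> h A [_ [[B oB <-] Bmu BA]].
have ptw : {ptws, (fun i => integrate_continuous (u i)) @ \oo --> integrate_continuous mu}.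
  apply/cvg_sup => phi V [_ [[W oW <-] Wmu WV]].
  have /(h phi (@cts_fun _ _ phi)) : nbhs (\int[mu]_x phi x) W by exact: open_nbhs_nbhs.
  by move=> [K _ KW]; exists K => // i Ki; apply: WV; exact: KW.
have : nbhs (integrate_continuous mu) B by exact: open_nbhs_nbhs.
by move/ptw; move=> [K _ KB]; exists K => // i Ki; apply: BA; exact: KB.
Qed.

Lemma weak_star_nbhs_lt (nu : probability (borel X) R) psi r : continuous psi ->
  \int[nu]_x psi x < r ->
  nbhs (nu : weak_star) [set kappa : weak_star | \int[(kappa : probability (borel X) R)]_x psi x < r].
Proof.
move=> cpsi nur.
pose Psi : continuousType X R := mkcts cpsi.
have cont : continuous (fun kappa : @weak_star R X => (integrate_continuous kappa) Psi).
  move=> kappa; apply: (@continuous_comp _ _ _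
    (@integrate_continuous R X : weak_star -> {ptws continuousType X R -> R}) (fun F => F Psi)).
    exact: initial_continuous.
  exact: (@proj_continuous _ (fun=> R) Psi).
exact: (cvgr_lt _ (cont nu)).
Qed.

(** The condition [i < n_ i] forces the times to infinity without monotonicity; the predecessor
    undoes the index shift in [empirical]. *)
Lemma subsequence_empirical_limit f x (mu : probability (borel X) R) (n_ : nat -> nat) :
  compact [set: X] -> (forall i, (i < n_ i)%N) ->
  (forall phi, continuous phi ->
    orbit_sum f phi (n_ i) x / (n_ i)%:R @[i --> \oo] --> \int[mu]_y phi y) ->
  generic_limit_set f mu x.
Proof.
move=> cX n_i h A B [N _ NA] Bmu.
have : (fun i => (empirical f x (n_ i).-1 : probability (borel X) R) : weak_star) @ \oo
    --> (mu : weak_star).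
  apply: weak_star_cvg => phi cphi; have := h phi cphi.
  rewrite (_ : (fun i => orbit_sum f phi (n_ i) x / (n_ i)%:R) =
     (fun i => \int[empirical f x (n_ i).-1]_y phi y))//.
  by apply/funext => i; rewrite Rintegral_empirical// prednK//; have := n_i i; lia.
move=> /(_ B Bmu) [N' _ N'B].
exists (empirical f x (n_ (maxn N N')).-1 : probability (borel X) R); split.
  by apply: NA => /=; have := n_i (maxn N N'); lia.
by apply: N'B => /=; exact: leq_maxr.
Qed.

(** For [r] strictly between the integral and [c], the averages of [psi] are eventually at least
    [r], whereas the measures giving [psi] an integral below [r] form a neighbourhood of [nu]. *)
Lemma not_generic_limit_of_orbit_sum f x (nu : probability (borel X) R) psi (c C : R) :
  compact [set: X] -> continuous psi -> \int[nu]_y psi y < c ->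
  (forall n, c * n%:R - C <= orbit_sum f psi n x) ->
  ~ generic_limit_set f nu x.
Proof.
move=> cX cpsi nuc lower; set I := \int[nu]_y psi y in nuc.
pose r := (I + c) / 2; have Ir : I < r by rewrite /r; lra.
have rc : r < c by rewrite /r; lra.
move=> cl; have nb := weak_star_nbhs_lt cpsi Ir.
pose K := Num.trunc (C / (c - r)).
have KP n : (K <= n)%N -> C <= (c - r) * n.+1%:R.
  move=> Kn; rewrite mulrC -ler_pdivrMr ?subr_gt0//.
  by rewrite (le_trans (ltW (truncnS_gt _)))// ler_nat ltnS.
have [] := cl [set kappa : weak_star | r <= \int[(kappa : probability (borel X) R)]_y psi y] _ _ nb.
  exists K => // n /= Kn; rewrite Rintegral_empirical// ler_pdivlMr//.
  by have := KP n Kn; have := lower n.+1; lra.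
by move=> kappa /= [h1 h2]; have := le_lt_trans h1 h2; rewrite ltxx.
Qed.

End Frequency.

(** * Small errors, diagonal argument and recurrent labels *)

Lemma near_geometric {R : realType} (e r : R) : 0 < e -> 0 < r ->
  exists K, forall k, (K <= k)%N -> e / 2 ^+ k < r.
Proof.
move=> e0 r0; exists (Num.trunc (e / r)).+1 => k Kk.
rewrite ltr_pdivrMr ?exprn_gt0// mulrC -ltr_pdivrMr//.
rewrite (lt_le_trans (truncnS_gt _))// -natrX ler_nat (leq_trans Kk)//.
by rewrite ltnW// ltn_expl.
Qed.

(** Cantor's diagonal: [xi] is false exactly at the codes of sequences that are true at their own
    code, and is then evaluated at its own code. *)
Lemma uncountable_range {T : Type} (z : (nat -> bool) -> T) :
  injective z -> ~ countable (range z).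
Proof.
move=> zinj /countable_injP[F Finj].
have zF xi eta : F (z xi) = F (z eta) -> xi = eta.
  by move=> h; apply/zinj/Finj => //; rewrite inE; [exists xi|exists eta].
pose xi n := ~~ `[< exists2 eta : nat -> bool, F (z eta) = n & eta n >].
have := erefl (xi (F (z xi))); rewrite {1}/xi.
case: asboolP => /= [[eta /zF <-]|H xin]; first by move=> ->.
by apply: H; exists xi => //; rewrite -xin.
Qed.

(** This makes the 2-adic valuation of [k.+1] a labelling of the stages in which every label
    recurs. *)
Lemma logn_values_recur v N : exists2 k, (N <= k)%N & logn 2 k.+1 = v.
Proof.
exists (2 ^ v * (2 * N).+1).-1; first by have := expn_gt0 2 v; nia.
have p0 : (0 < 2 ^ v * (2 * N).+1)%N by rewrite muln_gt0 expn_gt0.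
rewrite prednK// lognM ?expn_gt0// pfactorK// [X in (_ + X)%N]lognE.
by rewrite /= dvdn2 /= oddM /= addn0.
Qed.

(** * Averages at the end of a stage *)

Section Construction.
Context {R : realType} {X : pmetricType R}.
Implicit Types (f : X -> X) (phi psi : X -> R) (x y z : X).

(** Four errors of at most [eta / 4] relative to [L k.+1]: the initial stretch in the orbit sum, the
    same stretch in the multiple of the integral, the shadowing of [g], and the average of [g]
    itself. [K3] handles the first two, [K1] the third and [K2] the last. *)
Lemma follows_average f D L s a (e : R) target tracked z g
    (mu : probability (borel X) R) phi :
  compact [set: X] -> schedule D L s a -> follows f L s a e target tracked z ->
  0 < e -> generic_point f mu g -> continuous phi ->
  forall eta, 0 < eta -> exists K, forall k, (K <= k)%N -> tracked k = g ->
    `|\int[mu]_x phi x - orbit_sum f phi (L k.+1) z / (L k.+1)%:R| <= eta.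
Proof.
move=> cX sch fol e0 gen cphi eta eta0.
have [B0 phiB0] := compact_continuous_bounded cX cphi.
pose B := Num.max B0 1; have B_gt0 : 0 < B by rewrite lt_max ltr01 orbT.
have phiB x : `|phi x| <= B by rewrite le_max phiB0.
set I := \int[mu]_x phi x.
have IB : `|I| <= B.
  have := le_Rintegral_dist mu (bounded_measurable_continuous cX cphi)
    (bounded_measurable_cst (0 : R) : bounded_measurable (cst 0 : borel X -> R)) (e := B).
  by rewrite Rintegral_cst// mul0r subr0; apply => x; rewrite subr0.
have eta40 : 0 < eta / 4 by rewrite divr_gt0.
have [r r0 rP] := compact_uniform_continuous cX cphi eta40.
have [K1 K1P] := near_geometric e0 r0.
have [K2 _ K2P] : \forall n \near \oo, `|I - orbit_sum f phi n g / n%:R| <= eta / 4.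
  by move/cvgrPdist_le : (gen phi cphi); exact.
pose K3 := Num.trunc (B / (eta / 4)).
exists (maxn K1 (maxn K2 K3)).+1 => k; rewrite !gtn_max => /and3P[k1 k2 k3] trk.
have aL := schedule_ltS sch k; have [L0 Ls sa _ aL2] := sch k.
have kL := schedule_ge sch k.
pose n := (L k.+1 - a k)%N.
have Lan : L k.+1 = (a k + n)%N by rewrite /n; lia.
have n0 : (0 < n)%N by rewrite /n; lia.
have kn : (k <= n)%N by rewrite /n; nia.
have n0R : 0 < n%:R :> R by rewrite ltr0n.
have L0R : 0 < (L k.+1)%:R :> R by rewrite ltr0n; lia.
have track : `|orbit_sum f phi n (iter (a k) f z) - orbit_sum f phi n g| <= eta / 4 * n%:R.
  rewrite /orbit_sum -sumrB (le_trans (ler_norm_sum _ _ _))//.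
  rewrite mulr_natr -[n in leRHS]card_ord -sumr_const.
  apply: ler_sum => i _; rewrite iterDE.
  have [_ /(_ i (ltn_ord i)) h] := fol k; rewrite trk in h.
  by have := rP _ _ (le_lt_trans h (K1P k (ltnW k1))); rewrite -ball_normE/= distrC => /ltW.
have avg : `|I * n%:R - orbit_sum f phi n g| <= eta / 4 * n%:R.
  have := K2P n ltac:(rewrite /=; lia).
  rewrite -(ler_pM2r n0R) -{2}(gtr0_norm n0R) -normrM mulrBl divfK// gt_eqF//.
have head : `|orbit_sum f phi (a k) z| <= B * (a k)%:R.
  have := le_orbit_sum_dist f (a k) z (phi := phi) (psi := cst 0) (e := B).
  rewrite {2}/orbit_sum big1// subr0; apply => x; rewrite subr0//.
have aB : B * (a k)%:R <= eta / 4 * (L k.+1)%:R.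
  have Bk : B <= eta / 4 * k.+2%:R.
    rewrite mulrC -ler_pdivrMr// (le_trans (ltW (truncnS_gt _)))// ler_nat.
    exact: leq_trans k3 (leqW (leqnSn k)).
  apply: le_trans (ler_wpM2r _ Bk) _ => //.
  by rewrite -[leLHS]mulrA -natrM ler_pM2l// ler_nat.
have Ia : `|I * (a k)%:R| <= B * (a k)%:R by rewrite normrM normr_nat ler_wpM2r.
have nL : eta / 4 * n%:R <= eta / 4 * (L k.+1)%:R.
  by rewrite ler_pM2l// ler_nat Lan leq_addl.
rewrite -(ler_pM2r L0R) -{2}(gtr0_norm L0R) -normrM mulrBl divfK ?gt_eqF//.
rewrite {1 2}Lan orbit_sumD natrD mulrDr.
move: track avg head Ia; rewrite !ler_norml.
move=> /andP[? ?] /andP[? ?] /andP[? ?] /andP[? ?]; apply/andP; split; lra.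
Qed.

End Construction.

(** * The scrambled set *)

(* A measure of the library also assigns values to non-measurable sets,
   so distinctness of mu and nu means that they differ on some Borel set. *)
Theorem theorem2 (R : realType) (X : pmetricType R) (f : X -> X) (tau : R)
    (mu nu : probability (borel X) R) (U : set X) :
  0 <= tau ->
  dynamical_system f ->
  nonuniform_tau_specification f tau ->
  ergodic_measure f mu -> ergodic_measure f nu ->
  (exists2 A : set (borel X), measurable A & mu A <> nu A) ->
  open U -> U !=set0 ->
  exists S : set X,
    [/\ ~ countable S,
        DC1_scrambled f S
      & S `<=` (generic_limit_set f mu `\` generic_limit_set f nu)
                 `&` U `&` transitive_points f].
Proof.
move=> _ dyn [[M spec Mtau] _] emu enu mnu oU [u Uu].
have [cX _ cf] := dyn.
have [D gaps] := gap_tau_linear_gaps Mtau.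
(* Half the rate of the tracked orbits; [c'] is what the gaps leave of it, so the [nu]-integral of
   [psi] is chosen below [c']. *)
pose c : R := (16 * D.+1%:R)^-1.
have c0 : 0 < c by rewrite invr_gt0 mulr_gt0.
have c2E : 2 * c = (8 * D.+1%:R)^-1.
  by rewrite /c !invfM mulrA; congr (_ * _); lra.
pose c' := c / (2 * D.+2%:R).
have c'0 : 0 < c' by rewrite divr_gt0// mulr_gt0.
have [psi [cpsi psi01 mupsi nupsi]] := ergodic_separation cX cf emu enu mnu c'0.
have psi0 x : 0 <= psi x by have /andP[] := psi01 x.
have psi_near (r : R) : 0 < r -> exists2 d, 0 < d &
    forall x y, mdist x y < d -> psi x <= psi y + r.
  move=> r0; have [d d0 h] := compact_uniform_continuous cX cpsi r0.
  exists d => // x y xy; have := h x y xy; rewrite -ball_normE/= ltr_norml.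
  by move=> /andP[_ ?]; lra.
have [g gen] := ergodic_generic_point cX cf emu.
have [N gN] : exists N : nat, forall n, (N <= n)%N -> n%:R / 2 <= orbit_sum f psi n g.
  have [N _ h] := cvgr_ge _ (gen psi cpsi) _ mupsi.
  exists (maxn N 1) => n; rewrite geq_max => /andP[Nn n1].
  by have := h n Nn; rewrite /= ler_pdivlMr ?ltr0n// mulrC.
have [d d0 psid] := psi_near _ (ltac:(by rewrite invr_gt0) : 0 < 4^-1).
have [p [q [C [t [t0 pqt pS qS]]]]] := distal_tracking_pair dyn spec gaps psi0 d0 psid gN.
have [d' d'0 psid'] := psi_near _ c0.
have [r r0 rU] : exists2 r, 0 < r & forall x, mdist u x < r -> U x.
  have : nbhs u U by exact: open_nbhs_nbhs.
  by move/nbhs_ballP => [r /= r0 rU]; exists r => // x ux; apply: rU; rewrite ballEmdist.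
pose e := Num.min r d' / 2.
have m0 : 0 < Num.min r d' by rewrite lt_min r0.
have e0 : 0 < e by rewrite divr_gt0.
have [er ed'] : e < r /\ e < d'.
  have : e < Num.min r d' by rewrite /e; lra.
  by rewrite lt_min => /andP.
have [L [s [a [sch shadow]]]] := specification_schedule u cX cf spec gaps e0.
have [y yP] := compact_dense_sequence cX.
(* The label selects both the target and the orbit: label 0 follows [g], and label [i.+1] reads bit
   [i]. *)
pose h k := logn 2 k.+1.
pose target k := y (h k).
pose tracked (xi : nat -> bool) k := if h k is i.+1 then (if xi i then p else q) else g.
have [z zP] := choice (fun xi => shadow target (tracked xi)).
have sch' k : (k < L k)%N /\ (k.+2 * a k <= L k.+1)%N.
  by split; [exact: schedule_ge sch k|case: (sch k)].
have small (r' : R) : 0 < r' -> exists K, forall k, (K <= k)%N -> e / 2 ^+ k < r'.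
  exact: near_geometric.
have follow xi k j : (a k <= j < L k.+1)%N ->
    mdist (iter (j - a k) f (tracked xi k)) (iter j f (z xi)) <= e / 2 ^+ k.
  move=> /andP[aj jL]; have [_ /(_ k)[_ /(_ (j - a k)%N)]] := zP xi.
  by rewrite subnKC//; apply; rewrite ltn_sub2rE.
(* At late stages of label 0 both points follow [g]. *)
have close xi eta t' : 0 < t' -> forall K, exists2 k, (K <= k)%N &
    forall j, (a k <= j < L k.+1)%N -> mdist (iter j f (z xi)) (iter j f (z eta)) < t'.
  move=> t'0 K; have [K1 K1P] := small _ (divr_gt0 t'0 (ltr0n R 2)).
  have [k + hk] := logn_values_recur 0 (maxn K K1); rewrite geq_max => /andP[Kk Kk1].
  exists k => // j ajL.
  have := follow xi k j ajL; have := follow eta k j ajL; rewrite /tracked /h hk.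
  move: (iter (j - a k) f g) => w h1 h2.
  have := K1P k Kk1; have := metric_triangle (iter j f (z xi)) w (iter j f (z eta)).
  rewrite (metric_sym _ w); lra.
(* At stages reading a bit where the sequences differ, one point follows [p] and the other [q]; the
   two shadowing errors cost at most [t / 2]. *)
have far xi eta : xi <> eta -> forall K, exists2 k, (K <= k)%N &
    forall j, (a k <= j < L k.+1)%N -> t / 2 <= mdist (iter j f (z xi)) (iter j f (z eta)).
  move=> neq K; have [i xieta] : exists i, xi i != eta i.
    by apply: contrapT => H; apply/neq/funext => i; apply: contrapT => /eqP H'; apply: H; exists i.
  have [K1 K1P] := small _ (divr_gt0 t0 (ltr0n R 4)).
  have [k + hk] := logn_values_recur i.+1 (maxn K K1); rewrite geq_max => /andP[Kk Kk1].
  exists k => // j ajL.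
  have := follow xi k j ajL; have := follow eta k j ajL; rewrite /tracked /h hk.
  have := K1P k Kk1; have := pqt (j - a k)%N.
  have tri (v w v' w' : X) : mdist v w <= mdist v v' + mdist v' w' + mdist w w'.
    have := metric_triangle v v' w; have := metric_triangle v' w' w.
    rewrite (metric_sym w' w); lra.
  case: (xi i) (eta i) xieta => [] [] // _.
    have := tri (iter (j - a k) f p) (iter (j - a k) f q) (iter j f (z xi)) (iter j f (z eta)).
    lra.
  have := tri (iter (j - a k) f p) (iter (j - a k) f q) (iter j f (z eta)) (iter j f (z xi)).
  rewrite (metric_sym (iter j f (z eta)) (iter j f (z xi))); lra.
have zinj : injective z.
  move=> xi eta zE; apply: contrapT => /far/(_ 0%N)[k _ hk].
  have := hk (a k); rewrite zE mdistxx leqnn (schedule_ltS sch) => /(_ isT); lra.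
exists (range z); split; first exact: uncountable_range.
  move=> _ _ [xi _ <-] [eta _ <-] neq.
  apply: (DC1_pair_of_schedule (divr_gt0 t0 (ltr0n R 2)) sch'); first exact: close.
  by apply: far => xieta; apply: neq; rewrite xieta.
move=> _ [xi _ <-]; have [uz fol] := zP xi; split; first split; first split.
(* Stage [2 * i] has label 0, because its successor is odd. *)
- apply: (@subsequence_empirical_limit _ _ _ _ _ (fun i => L (2 * i).+1) cX).
    move=> i; apply: leq_trans (schedule_ge sch _).
    by rewrite ltnS leqW// mulSn mul1n leq_addr.
  move=> phi cphi; apply/cvgrPdist_le => /= eta eta0.
  have [K KP] := follows_average cX sch fol e0 gen cphi eta0.
  exists K => // i /= Ki; apply: KP; first by rewrite mulSn mul1n (leq_trans Ki)// leq_addr.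
  by rewrite /tracked /h lognE /= dvdn2 /= oddM.
- have [C' C'P] : exists C', forall m, c' * m%:R - C' <= orbit_sum f psi m (z xi).
    (* The constant serves all three tracked orbits: [C] for [p] and [q], and [N] for [g], whose
       averages are controlled only from length [N] on. *)
    apply: (follows_orbit_sum_ge (C := Num.max N%:R C) sch fol e0 psi0 c0).
    - by rewrite le_max ler0n.
    - by move=> x w xw; apply: psid'; exact: le_lt_trans ed'.
    - move=> k m; rewrite c2E.
      have CC : C <= Num.max N%:R C by rewrite le_max lexx orbT.
      rewrite /tracked; case: (h k) => [|i]; last first.
        by case: (xi i); [apply: le_trans (pS m)|apply: le_trans (qS m)]; rewrite lerB.
      have NC : N%:R <= Num.max N%:R C by rewrite le_max lexx.
      have c1 : (8 * D.+1%:R)^-1 * m%:R <= m%:R / 2 :> R.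
        rewrite mulrC ler_wpM2l// lef_pV2 ?posrE ?mulr_gt0//.
        have : (1 : R) <= D.+1%:R by rewrite ler1n.
        lra.
      apply: le_trans (lerB c1 NC) _; have [Nm|mN] := leqP N m.
        by apply: le_trans (gN m Nm); rewrite gerBl.
      apply: le_trans (orbit_sum_nonneg f m g psi0); rewrite subr_le0.
      have : m%:R <= N%:R :> R by rewrite ler_nat ltnW.
      have := ler0n R m; lra.
  exact: (not_generic_limit_of_orbit_sum cX cpsi nupsi C'P).
- by apply: rU; exact: le_lt_trans er.
(* For transitivity, a term [y v] near [w] is the target at all stages of label [v], hence is
   approached arbitrarily late and closely. *)
apply/seteqP; split=> // w _ A B [K _ KA] /nbhs_ballP[r' /= r'0]; rewrite ballEmdist => r'B.
have [V VP] := yP (r' / 2) ltac:(by rewrite divr_gt0).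
have [v _ yw] := VP w.
have [K1 K1P] := small _ (divr_gt0 r'0 (ltr0n R 2)).
have [k + hk] := logn_values_recur v (maxn K K1); rewrite geq_max => /andP[Kk Kk1].
exists (iter (s k) f (z xi)); split.
  have [_ Ls _ _ _] := sch k; apply: KA => /=.
  exact: leq_trans Kk (leq_trans (ltnW (schedule_ge sch k)) Ls).
apply: r'B => /=; have [h1 _] := fol k; rewrite /target /h hk in h1.
have := metric_triangle w (y v) (iter (s k) f (z xi)); have := K1P k Kk1.
rewrite (metric_sym w (y v)); lra.
Qed.
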